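(* Let $G=\langle s_1,\ldots,s_r\rangle$ be a free group on $r$ generators, and let $T$ be the Bernoulli shift over $G$ with base measure $\kappa$, where $\kappa$ is a probability measure on a finite or countable set $K$. If $S$ is a factor of $T$ and if there exists a finite generating partition for $S$, then $f(S)\ge 0$.
   Context: A measure-preserving action $T=(T_g)_{g\in G}$ of $G$ on a standard probability space $(X,\mu)$ consists of measure-preserving maps $T_g:X\to X$ with $T_{g_1}T_{g_2}=T_{g_1g_2}$. The Bernoulli shift over $G$ with base measure $\kappa$ is the action on the product space $(K^G,\kappa^G)$ given by $T_g(x)(h)=x(hg)$. An action $S$ of $G$ on a standard probability space $(Y,\nu)$ is a factor of an action $T$ on $(X,\mu)$ if there is a measurable map $\phi:X\to Y$ with $\phi_*\mu=\nu$ and $\phi(T_gx)=S_g\phi(x)$ for all $g\in G$ and a.e. $x\in X$. A countable measurable partition $\alpha$ is generating if the smallest $G$-invariant $\sigma$-algebra containing $\alpha$ equals the $\sigma$-algebra of all measurable sets up to sets of measure zero. For an action $S$ on $(Y,\nu)$ and a countable measurable partition $\alpha$ of $Y$: $H(\alpha)=-\sum_{P\in\alpha}\nu(P)\log\nu(P)$ (with $0\log0=0$), and $\alpha\vee\beta=\{P\cap Q: P\in\alpha,Q\in\beta\}$. Let $B(e,n)$ be the ball of radius $n$ around the identity $e$ in $G$ for the word metric of $\{s_1^{\pm1},\ldots,s_r^{\pm1}\}$. Define $$F(S,\alpha)=(1-2r)H(\alpha)+\sum_{i=1}^rH(\alpha\vee S_{s_i}^{-1}\alpha),\qquad \alpha^n=\bigvee_{g\in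 B(e,n)}S_g^{-1}\alpha,\qquad f(S,\alpha)=\inf_nF(S,\alpha^n).$$ The $f$-invariant of the action is $f(S):=f(S,\alpha)$, where $\alpha$ is any generating partition with $H(\alpha)<\infty$ (if one exists); by a previously known theorem of Bowen the value does not depend on the choice of such $\alpha$. *)

(* Defs.v *)
From HB Require Import structures.
From mathcomp Require Import all_boot all_order all_algebra.
From mathcomp Require Import all_classical all_reals all_analysis.
Import Order.TTheory GRing.Theory Num.Theory.
Import numFieldNormedType.Exports.

Set Implicit Arguments.
Unset Strict Implicit.
Unset Printing Implicit Defensive.

Local Open Scope classical_set_scope.
Local Open Scope ring_scope.

(* A word in the letters s_i (encoded (i, true)) and s_i^-1 (encoded
   (i, false)). *)
Definition word (r : nat) : Type := seq ('I_r * bool).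

Definition letter_val (G : groupType) (r : nat) (s : 'I_r -> G)
    (l : 'I_r * bool) : G :=
  (if l.2 then s l.1 else (s l.1)^-1)%g.

Definition word_val (G : groupType) (r : nat) (s : 'I_r -> G)
    (w : word r) : G :=
  foldr (fun l g => (letter_val s l * g)%g) 1%g w.

Definition reduced (r : nat) (w : word r) : bool :=
  sorted (fun l m => ~~ ((l.1 == m.1) && (l.2 != m.2))) w.

(* G is a free group with free basis s_1, ..., s_r: the s_i generate G and no
   nonempty reduced word in them is trivial. *)
Definition free_basis (G : groupType) (r : nat) (s : 'I_r -> G) : Prop :=
  (forall g : G, exists w : word r, word_val s w = g) /\
  (forall w : word r, reduced w -> word_val s w = 1%g -> w = [::]).

Definition word_ball (G : groupType) (r : nat) (s : 'I_r -> G) (n : nat) :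
    set G :=
  [set g | exists2 w : word r, (size w <= n)%N & word_val s w = g].

(* Polish spaces are the separable completely metrizable ones; they are
   presented here as the second countable Hausdorff complete pseudometric
   spaces. *)
Definition standard_borel (R : realType) (d : measure_display)
    (Y : measurableType d) : Prop :=
  exists (Z : completePseudoMetricType R) (f : Y -> Z),
    [/\ hausdorff_space Z, @second_countable Z, bijective f &
        forall A : set Y, measurable A <-> <<s @open Z >> (f @` A)].

(* As in ergodic theory texts that only ask for T_g T_h = T_(gh), the identity
   T_1 = id is not required; it holds up to null sets. *)
Definition mp_action (R : realType) (G : groupType) (d : measure_display)
    (X : measurableType d) (mu : probability X R) (T : G -> X -> X) : Prop :=
  [/\ forall g, measurable_fun setT (T g),
      forall g (A : set X), measurable A -> mu (T g @^-1` A) = mu A &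
      forall g h x, T g (T h x) = T (g * h)%g x].

Definition is_factor (R : realType) (G : groupType)
    (dX dY : measure_display) (X : measurableType dX) (Y : measurableType dY)
    (mu : probability X R) (T : G -> X -> X)
    (nu : probability Y R) (S : G -> Y -> Y) : Prop :=
  exists phi : X -> Y,
    [/\ measurable_fun setT phi,
        forall A : set Y, measurable A -> pushforward mu phi A = nu A &
        forall g, {ae mu, forall x, phi (T g x) = S g (phi x)}].

Definition cylinders (G : Type) (d : measure_display) (K : measurableType d) :
    set_system (G -> K) :=
  [set C | exists (g : G) (A : set K),
             measurable A /\ C = [set x | A (x g)]].

(* K^G with the product sigma-algebra *)
Definition config (G : Type) (d : measure_display) (K : measurableType d) :=
  g_sigma_algebraType (@cylinders G d K).

(* mu = kappa^G: since finite-dimensional cylinders form a pi-system generating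
   the sigma-algebra, these values determine mu. *)
Definition is_product_measure (R : realType) (G : choiceType)
    (d : measure_display) (K : measurableType d) (kappa : probability K R)
    (mu : probability (config G K) R) : Prop :=
  forall (D : seq G) (A : G -> set K),
    uniq D -> (forall g, measurable (A g)) ->
    mu [set x | forall g, g \in D -> A g (x g)] =
      (\prod_(g <- D) kappa (A g))%E.

Definition bernoulli_shift (G : groupType) (d : measure_display)
    (K : measurableType d) (g : G) (x : config G K) : config G K :=
  fun h => x (h * g)%g.

(* Partitions are sets of cells. The empty cell is allowed: it has no effect
   on entropies, and joins may contain it. *)
Definition countable_partition (d : measure_display) (Y : measurableType d)
    (alpha : set_system Y) : Prop :=
  [/\ countable alpha, forall P, alpha P -> measurable P,
      trivIset alpha id & \bigcup_(P in alpha) P = setT].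

Definition partition_preimage (Y : Type) (f : Y -> Y) (alpha : set_system Y) :
    set_system Y :=
  [set f @^-1` P | P in alpha].

Definition partition_join (Y : Type) (alpha beta : set_system Y) :
    set_system Y :=
  [set P `&` Q | P in alpha & Q in beta].

(* The join of the family (alpha_i), i in D *)
Definition partition_bigjoin (I Y : Type) (D : set I)
    (alpha : I -> set_system Y) : set_system Y :=
  [set A | exists2 P : I -> set Y,
             forall i, D i -> alpha i (P i) & A = \bigcap_(i in D) P i].

(* The smallest G-invariant sigma-algebra containing alpha *)
Definition invariant_sigma_algebra (G Y : Type) (S : G -> Y -> Y)
    (alpha : set_system Y) : set_system Y :=
  smallest [set F | sigma_algebra setT F /\
                    forall g A, F A -> F (S g @^-1` A)] alpha.

Definition generating (R : realType) (G : groupType) (d : measure_display)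
    (Y : measurableType d) (nu : probability Y R) (S : G -> Y -> Y)
    (alpha : set_system Y) : Prop :=
  countable_partition alpha /\
  forall A : set Y, measurable A ->
    exists2 B, invariant_sigma_algebra S alpha B & nu (A `+` B) = 0%E.

(* ln 0 = 0, so null cells contribute 0. *)
Definition entropy (R : realType) (d : measure_display) (Y : measurableType d)
    (nu : probability Y R) (alpha : set_system Y) : \bar R :=
  (\esum_(P in alpha) (- (fine (nu P) * ln (fine (nu P))))%:E)%E.

(* Only meaningful for entropy nu alpha < +oo, in which case all the terms are
   finite. *)
Definition F_value (R : realType) (G : groupType) (r : nat) (s : 'I_r -> G)
    (d : measure_display) (Y : measurableType d) (nu : probability Y R)
    (S : G -> Y -> Y) (alpha : set_system Y) : \bar R :=
  ((1 - 2 * r%:R)%:E * entropy nu alpha +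
   \sum_(i < r)
     entropy nu (partition_join alpha (partition_preimage (S (s i)) alpha)))%E.

Definition ball_refinement (G : groupType) (r : nat) (s : 'I_r -> G)
    (Y : Type) (S : G -> Y -> Y) (alpha : set_system Y) (n : nat) :
    set_system Y :=
  partition_bigjoin (word_ball s n) (fun g => partition_preimage (S g) alpha).

Definition f_value (R : realType) (G : groupType) (r : nat) (s : 'I_r -> G)
    (d : measure_display) (Y : measurableType d) (nu : probability Y R)
    (S : G -> Y -> Y) (alpha : set_system Y) : \bar R :=
  ereal_inf (range (fun n => F_value s nu S (ball_refinement s S alpha n))).

(* c is the f-invariant f(S) of the action, as computed by some generating
   partition of finite entropy. That c is unique is a theorem of Bowen; the
   relational form does not presuppose it. *)
Definition is_f_invariant (R : realType) (G : groupType) (r : nat)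
    (s : 'I_r -> G) (d : measure_display) (Y : measurableType d)
    (nu : probability Y R) (S : G -> Y -> Y) (c : \bar R) : Prop :=
  exists alpha : set_system Y,
    [/\ generating nu S alpha, (entropy nu alpha < +oo)%E &
        c = f_value s nu S alpha].

(* Main.v *)
Require Import Defs.
From HB Require Import structures.
From mathcomp Require Import all_boot all_order all_algebra all_fingroup.
From mathcomp Require Import ring lra.
From mathcomp Require Import all_classical all_reals all_analysis.
Import Order.TTheory GRing.Theory Num.Theory.
Import numFieldNormedType.Exports.

Set Implicit Arguments.
Unset Strict Implicit.
Unset Printing Implicit Defensive.

Local Open Scope classical_set_scope.
Local Open Scope ring_scope.

(** The f-invariant of a generating partition alpha is the infimum of the numbers
    F(S, beta), where beta runs over the joins of the translates of alpha by the
    elements of a ball. These beta are countable partitions of finite entropy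
    ([bigjoin_finite_entropy]), so it is enough to show that F(S, beta) >= 0 for
    every such beta ([F_value_ge0]), that is

      (2r - 1) H(beta) <= sum_i H(beta v S_i^-1 beta).

    Think of the Cayley graph of G as a 2r-regular tree whose vertex g carries the
    label Z(T_g x) of a point x of the Bernoulli shift: a vertex has entropy H(Z),
    and the inequality bounds the entropies of the edges below. It is obtained by
    sharing out the entropies among the coordinates x(u), the seeds, which are
    independent.

    Assume first that Z depends on finitely many seeds only. Reveal the seeds in a
    uniformly random order and let h(u) be the expected information gained on the
    label of the identity when x(u) is revealed ([contrib]). Then h >= 0, the sum
    of h is H(Z) ([sum_contrib]), and a seed that does not influence Z gets
    nothing ([contrib_eq0]). Because the order is random, the shares do not
    see how the seeds are named ([contrib_permute]): the seed u gives h(u s_i^-1)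
    to the vertex s_i. By strong subadditivity ([rv_entropy_submod]) it gives to
    the edge between the identity and s_i at least what it gives to either
    endpoint ([le_contrib]). Hence this edge has entropy at least

      sum_u max(h(u), h(u s_i^-1)) = 2 H(Z) - sum_u min(h(u), h(u s_i^-1)).

    Over all i, the sums of minima range over the edges of the tree; charging the
    minimum on an edge to its endpoint farther from the identity, every vertex is
    charged at most once, so they add up to at most the sum of h, which is H(Z)
    ([sum_edge_min_le]). Adding the edge bounds gives the inequality for local
    labels ([edge_vertex_entropy_finite]).

    Every finite-valued label of the Bernoulli shift is the limit of local ones,
    and both sides are continuous ([bernoulli_edge_vertex_entropy]). The
    inequality only involves laws of labels, so it passes to the factor
    ([factor_edge_vertex_entropy]), and truncating a countable partition to
    finitely many cells extends it to partitions of finite entropy. *)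

(** * The Cayley graph of a free group is a tree *)

Section FreeGroup.
Variables (G : groupType) (r : nat) (s : 'I_r -> G).

Definition letter_inv (l : 'I_r * bool) : 'I_r * bool := (l.1, ~~ l.2).

Lemma letter_val_inv l : letter_val s (letter_inv l) = ((letter_val s l)^-1)%g.
Proof. by case: l => i [] //=; rewrite /letter_val /= invgK. Qed.

Lemma word_val_cat (v w : word r) :
  word_val s (v ++ w) = (word_val s v * word_val s w)%g.
Proof. by elim: v => [|l v IH] /=; rewrite ?mul1g // IH mulgA. Qed.

Definition word_inv (w : word r) : word r := rev (map letter_inv w).

Lemma word_val_inv w : word_val s (word_inv w) = ((word_val s w)^-1)%g.
Proof.
elim: w => [|l w IH]; first by rewrite /= invg1.
rewrite /word_inv /= rev_cons -cats1 word_val_cat -/(word_inv w) IH /=.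
by rewrite letter_val_inv mulg1 invgM.
Qed.

Lemma reduced_inv w : reduced w -> reduced (word_inv w).
Proof.
rewrite /reduced /word_inv rev_sorted sorted_map; apply: sub_sorted => l m /=.
by case: l m => i b [j c] /=; rewrite eq_sym; case: (_ == _); case: b; case: c.
Qed.

(** Common first letters cancel; once the first letters differ, the inverse of
    one word followed by the other is a nonempty reduced word of value 1. *)
Lemma reduced_word_inj (hG : free_basis s) (v w : word r) :
  reduced v -> reduced w -> word_val s v = word_val s w -> v = w.
Proof.
case: hG => _ free; elim: v w => [|l v IH] [|m w] //.
- by move=> _ rw /esym e; rewrite (free _ rw e).
- by move=> rv _ e; rewrite (free _ rv e).
move=> rv rw; have [->|lm] := eqVneq l m.
  move=> /= /mulgI e; congr cons; apply: IH e; first exact: path_sorted rv.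
  exact: path_sorted rw.
move=> e; have : word_inv (l :: v) ++ m :: w = [::].
  apply: free; last by rewrite word_val_cat word_val_inv e mulVg.
  move: (reduced_inv rv); rewrite /word_inv /= rev_cons /reduced.
  case: (rev _) => [|k u] /=; last first.
    rewrite rcons_path cat_path rcons_path last_rcons => /andP[-> ->] /=.
    rewrite (_ : path _ m w) ?andbT //; move: lm; rewrite /letter_inv.
    by case: l m {rv rw e} => i [] [j []]; rewrite -?pair_eqE /=; case: (i == j).
  move=> _; rewrite (_ : path _ m w) ?andbT //; move: lm; rewrite /letter_inv.
  by case: l m {rv rw e} => i [] [j []]; rewrite -?pair_eqE /=; case: (i == j).
by case: (word_inv _).
Qed.

Lemma reduced_word_exists (hG : free_basis s) (g : G) :
  exists2 w : word r, reduced w & word_val s w = g.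
Proof.
case: hG => gen _; have [w <-] := gen g; elim: w {g} => [|l w [v rv /= <-]].
  by exists [::].
case: v rv => [|m v] rv; first by exists [:: l].
have [e|/negbTE e] := boolP ((l.1 == m.1) && (l.2 != m.2)); last first.
  by exists [:: l, m & v] => //; rewrite /reduced /= e.
exists v; first exact: path_sorted rv.
have -> : l = letter_inv m.
  by move: e; case: l m {rv} => i [] [j []] //= /andP[/eqP->].
by rewrite /= letter_val_inv mulKg.
Qed.

(** [L g] is the first letter of the reduced word of [g]. The unique neighbour of
    [g] closer to the identity is got by erasing it, and of the two endpoints of
    an edge one is closer than the other. *)
Lemma edge_head (hG : free_basis s) :
  exists L : G -> option ('I_r * bool),
    forall i g, L g = Some (i, false) \/ L (s i * g)%g = Some (i, true).
Proof.
have /choice[nf nfP] : forall g, exists w : word r, reduced w /\ word_val s w = g.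
  by move=> g; have [w] := reduced_word_exists hG g; exists w.
exists (fun g => ohead (nf g)) => i g; have [rg vg] := nfP g.
have [e|ne] := eqVneq (ohead (nf g)) (Some (i, false)); [by left | right].
rewrite -(@reduced_word_inj hG ((i, true) :: nf g) (nf _)) //.
- move: ne rg; rewrite /reduced; case: (nf g) => //= -[j []] w //= ne ->.
    by rewrite andbF.
  by rewrite andbT; move: ne; apply: contra => /andP[/eqP->].
- exact: (nfP _).1.
- by rewrite (nfP _).2 /= vg.
Qed.

End FreeGroup.

(** Moving the weight of each edge to the endpoint chosen by [edge_head] charges
    every vertex at most once: this is the bound by 1 of the edge to vertex
    ratio of finite forests, in weighted form. *)
Lemma sum_edge_min_le (R : realDomainType) (G : groupType) (r : nat)
    (s : 'I_r -> G) (hG : free_basis s) (n : nat) (e : 'I_n -> G)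
    (gam : G -> R) :
  injective e -> (forall g, 0 <= gam g) ->
  (forall g, gam g != 0 -> exists k, e k = g) ->
  \sum_(i < r) \sum_(k < n) Num.min (gam (e k)) (gam (e k * (s i)^-1)%g)
    <= \sum_(k < n) gam (e k).
Proof.
move=> e_inj gam0 gamS; have [L LP] := edge_head hG.
(* The edge (i, k) joins e k and e k * (s i)^-1. Inverting the vertices turns the
   right multiplications of the statement into the left ones of [edge_head]. *)
pose tau (x : 'I_r * 'I_n) : G :=
  if L (e x.2)^-1%g == Some (x.1, false) then e x.2 else (e x.2 * (s x.1)^-1)%g.
have tauP x : L (tau x)^-1%g = Some (x.1, tau x != e x.2).
  rewrite /tau; case: eqP => [->|ne]; first by rewrite eqxx.
  have [//|] := LP x.1 (e x.2)^-1%g.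
  rewrite invgM invgK => ->; congr (Some (_, _)); apply/esym/eqP => E.
  have s1 : s x.1 = 1%g by apply: (mulgI (e x.2)); rewrite mulg1 -{1}E mulgKV.
  (* The edge would be a loop, but a generator is not trivial. *)
  have := hG.2 [:: (x.1, true)] isT.
  by rewrite /= /letter_val /= mulg1 => /(_ s1).
have tau_inj : injective tau.
  move=> [i k] [j l] E.
  have : Some (i, tau (i, k) != e k) = Some (j, tau (j, l) != e l).
    by rewrite -(tauP (i, k)) -(tauP (j, l)) E.
  case=> ij; subst j; move: E.
  have [tl|nl] := eqVneq (tau (i, l)) (e l); have [tk|nk] := eqVneq (tau (i, k)) (e k).
  - by move=> E _; move: E; rewrite tl tk => /e_inj->.
  - by [].
  - by [].
  have tauN m : tau (i, m) != e m -> tau (i, m) = (e m * (s i)^-1)%g.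
    by rewrite /tau /=; case: ifP => //; rewrite eqxx.
  by rewrite (tauN _ nk) (tauN _ nl) => /mulIg/e_inj->.
rewrite pair_big /=.
apply: (@le_trans _ _ (\sum_(x : 'I_r * 'I_n) gam (tau x))).
  apply: ler_sum => x _; rewrite /tau.
  by case: ifP => _; rewrite ge_min lexx ?orbT.
have gamE g : gam g = \sum_(k < n) (e k == g)%:R * gam (e k).
  have [g0|/gamS[k <-]] := eqVneq (gam g) 0.
    rewrite g0 big1 // => k _; case: eqP => [->|]; last by rewrite mul0r.
    by rewrite g0 mulr0.
  rewrite (bigD1 k) //= eqxx mul1r big1 ?addr0 // => l lk.
  by rewrite (inj_eq e_inj) (negbTE lk) mul0r.
rewrite (eq_bigr _ (fun x _ => gamE (tau x))) exchange_big /=.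
apply: ler_sum => k _; rewrite -mulr_suml ler_piMl //.
have [[x xk]|nx] := pselect (exists x, e k = tau x).
  rewrite (bigD1 x) //= xk eqxx big1 ?addr0 // => y yx.
  by rewrite (inj_eq tau_inj) eq_sym (negbTE yx).
by rewrite big1 // => y _; case: eqP => // E; case: nx; exists y.
Qed.

(** * Entropy of random variables on a finite probability space *)

Section FiniteEntropy.
Variables (R : realType) (Om : finType) (P : Om -> R).
Hypothesis P0 : forall w, 0 <= P w.

(** The probability that [X] takes again its value at [w]. It depends on [X]
    only through its level sets, which makes relabelling invisible. *)
Definition level_mass (T : eqType) (X : Om -> T) (w : Om) : R :=
  \sum_(w' | X w' == X w) P w'.

(** The Shannon entropy, summed over outcomes instead of values. *)
Definition rv_entropy (T : eqType) (X : Om -> T) : R :=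
  \sum_w P w * - ln (level_mass X w).

Lemma level_mass_ge (T : eqType) (X : Om -> T) w : P w <= level_mass X w.
Proof. by rewrite /level_mass (bigD1 w) //= lerDl sumr_ge0. Qed.

Lemma level_mass_gt0 (T : eqType) (X : Om -> T) w : 0 < P w -> 0 < level_mass X w.
Proof. by move=> /lt_le_trans; apply; exact: level_mass_ge. Qed.

Lemma eq_rv_entropy (T U : eqType) (X : Om -> T) (Y : Om -> U) :
  (forall w w', (X w == X w') = (Y w == Y w')) -> rv_entropy X = rv_entropy Y.
Proof.
move=> XY; apply: eq_bigr => w _; congr (_ * - ln _).
by apply: eq_bigl => w'; rewrite XY.
Qed.

Lemma sum_level_le1 (T : eqType) (X : Om -> T) (t : T) :
  \sum_(w | X w == t) P w / level_mass X w <= 1.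
Proof.
(* The sum is 0, and not 1, when the level set is null. *)
set c := \sum_(w | X w == t) P w.
rewrite (eq_bigr (fun w => P w / c)); last first.
  move=> w /eqP Xw; congr (_ / _); apply: eq_bigl => w'; by rewrite Xw.
by rewrite -mulr_suml -/c; have [->|c0] := eqVneq c 0; rewrite ?mul0r ?divff.
Qed.

Lemma ln_le_subr1 (x : R) : 0 < x -> ln x <= x - 1.
Proof.
by move=> x0; rewrite -{1}[x](subrK 1) addrC; apply: le_ln1Dx; rewrite ltrBrDl subrr.
Qed.

(** Strong subadditivity. By [ln x <= x - 1], the difference of the two sides is
    at least the total mass minus that of the weight p(x,y) p(y,z) / p(y), under
    which the first and the last variable are independent given the middle
    one. *)
Lemma rv_entropy_submod (T U V : eqType) (X : Om -> T) (Y : Om -> U) (Z : Om -> V) :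
  rv_entropy (fun w => (X w, Y w, Z w)) + rv_entropy Y
    <= rv_entropy (fun w => (X w, Y w)) + rv_entropy (fun w => (Y w, Z w)).
Proof.
set mXYZ := level_mass (fun w => (X w, Y w, Z w)).
set mXY := level_mass (fun w => (X w, Y w)).
set mYZ := level_mass (fun w => (Y w, Z w)); set mY := level_mass Y.
rewrite -subr_le0 -!big_split -sumrB /=.
apply: (@le_trans _ _ (\sum_w (P w * (mXY w * mYZ w / mY w / mXYZ w) - P w))).
  apply: ler_sum => w _; rewrite -!mulrDr -mulrBr -{3}[P w]mulr1 -mulrBr.
  have [Pw|Pw] := ltP 0 (P w); last first.
    by rewrite (_ : P w = 0) ?mul0r //; apply/eqP; rewrite eq_le Pw P0.
  have g1 : 0 < mXY w by exact: level_mass_gt0.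
  have g2 : 0 < mYZ w by exact: level_mass_gt0.
  have g3 : 0 < mY w by exact: level_mass_gt0.
  have g4 : 0 < mXYZ w by exact: level_mass_gt0.
  rewrite ler_wpM2l //; apply: le_trans (ln_le_subr1 _); last first.
    by rewrite !divr_gt0 ?mulr_gt0.
  rewrite !ln_div ?lnM ?posrE ?divr_gt0 ?mulr_gt0 //.
  by rewrite le_eqVlt; apply/orP; left; apply/eqP; ring.
rewrite sumrB subr_le0.
(* Expand p(x,y) and p(y,z) into sums over outcomes a and b: the outcomes w that
   agree with a on X, with b on Z and with both on Y then contribute at most
   P a * P b / p(y). *)
pose S a b w := [&& X w == X a, Y w == Y a & Z w == Z b].
have -> : \sum_w P w * (mXY w * mYZ w / mY w / mXYZ w) =
    \sum_a \sum_(b | Y b == Y a) P a * (P b / mY a) * \sum_(w | S a b w) P w / mXYZ w.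
  transitivity (\sum_w \sum_(a | (X a, Y a) == (X w, Y w))
      \sum_(b | (Y b, Z b) == (Y w, Z w)) P a * (P b / mY w) * (P w / mXYZ w)).
    apply: eq_bigr => w _; rewrite (_ : _ * _ =
      mXY w * (mYZ w / mY w) * (P w / mXYZ w)); last by ring.
    rewrite [mYZ w / _]mulr_suml big_distrlr mulr_suml; apply: eq_bigr => a _.
    by rewrite mulr_suml.
  rewrite (exchange_big_dep predT) //=; apply: eq_bigr => a _ /=.
  rewrite (exchange_big_dep (fun b => Y b == Y a)) /=; last first.
    by move=> w b; rewrite !xpair_eqE => /andP[_ /eqP->] /andP[].
  apply: eq_bigr => b /eqP Yba; rewrite mulr_sumr.
  rewrite (eq_bigl (S a b)); last first.
    move=> w; rewrite /S !xpair_eqE Yba (eq_sym (X a)) (eq_sym (Y a)) (eq_sym (Z b)).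
    by case: (X w == _); case: (Y w == _).
  apply: eq_bigr => w /and3P[_ /eqP Yw _]; congr (_ * (_ / _) * _).
  by apply: eq_bigl => w'; rewrite Yw.
apply: ler_sum => a _.
apply: (@le_trans _ _ (\sum_(b | Y b == Y a) P a * (P b / mY a))).
  apply: ler_sum => b _; rewrite ler_piMr //.
    by rewrite mulr_ge0 ?divr_ge0 // /mY sumr_ge0.
  rewrite (eq_bigl (fun w => (X w, Y w, Z w) == (X a, Y a, Z b))).
    exact: sum_level_le1.
  by move=> w; rewrite /S !xpair_eqE andbA.
rewrite -mulr_sumr -mulr_suml -/(level_mass Y a) -/mY ler_piMr //.
by have [->|c0] := eqVneq (mY a) 0; rewrite ?mul0r ?divff.
Qed.

End FiniteEntropy.

Lemma rv_entropy_comp (R : realType) (Om : finType) (P : Om -> R) (T : eqType)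
    (X : Om -> T) (f : Om -> Om) :
  bijective f -> (forall w, P (f w) = P w) ->
  rv_entropy P (X \o f) = rv_entropy P X.
Proof.
move=> f_bij Pf; have fI : injective f by exact: bij_inj.
rewrite [RHS](reindex_inj fI); apply: eq_bigr => w _ /=.
rewrite Pf; congr (_ * - ln _); rewrite /level_mass [RHS](reindex_inj fI) /=.
by apply: eq_bigr => w' _; rewrite Pf.
Qed.

(** * Distributing the entropy among independent seeds *)

Section Shapley.
Variables (R : realType) (A : finType) (n : nat) (p : A -> R).
Hypotheses (p0 : forall a, 0 <= p a) (p1 : \sum_a p a = 1).

Local Notation seeds := {ffun 'I_n -> A}.

Definition iid_mass (w : seeds) : R := \prod_(i < n) p (w i).

Local Notation H := (rv_entropy iid_mass).

Lemma iid_mass_ge0 w : 0 <= iid_mass w.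
Proof. by apply: prodr_ge0 => i _. Qed.

Lemma iid_mass_sum1 : \sum_w iid_mass w = 1.
Proof. by rewrite -(bigA_distr_bigA (fun _ => p)) big1. Qed.

Definition coords (B : {set 'I_n}) (w : seeds) : {ffun 'I_n -> option A} :=
  [ffun i => if i \in B then Some (w i) else None].

Lemma coordsP (B : {set 'I_n}) (w w' : seeds) :
  reflect {in B, w =1 w'} (coords B w == coords B w').
Proof.
apply: (iffP eqP) => [/ffunP E i iB|E].
  by have := E i; rewrite !ffunE iB => -[].
by apply/ffunP => i; rewrite !ffunE; case: ifP => // /E->.
Qed.

(** Up to the constant [H Z], the mutual information between [Z] and the seeds
    in [B]. *)
Definition info (T : eqType) (Z : seeds -> T) (B : {set 'I_n}) : R :=
  H (coords B) - H (fun w => (Z w, coords B w)).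

Definition marginal (T : eqType) (Z : seeds -> T) (B : {set 'I_n}) u : R :=
  info Z (u |: B) - info Z B.

Definition prefix_set (sg : {perm 'I_n}) (k : nat) : {set 'I_n} :=
  [set v | (sg v < k)%N].

(** The Shapley value of the seed [u] in the game [info Z]: the average
    information on [Z] gained when the seeds are revealed in a uniformly random
    order. Averaging over the orders makes it equivariant under permutations of
    the seeds. *)
Definition contrib (T : eqType) (Z : seeds -> T) (u : 'I_n) : R :=
  (#|{perm 'I_n}|%:R)^-1 *
  \sum_(sg : {perm 'I_n}) marginal Z (prefix_set sg (sg u)) u.

Lemma prefix_setS (sg : {perm 'I_n}) u :
  u |: prefix_set sg (sg u) = prefix_set sg (sg u).+1.
Proof.
apply/setP => v; rewrite !inE (ltnS (sg v) (sg u)) (leq_eqVlt (sg v) (sg u)).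
by rewrite -(inj_eq (@perm_inj _ sg)).
Qed.

Lemma card_perm_gt0 : 0 < #|{perm 'I_n}|%:R :> R.
Proof. by rewrite ltr0n; apply/card_gt0P; exists 1%g. Qed.

Lemma sum_contrib (T : eqType) (Z : seeds -> T) : \sum_u contrib Z u = H Z.
Proof.
(* For a fixed order the gains telescope, from no seed to all of them. *)
have telescope (sg : {perm 'I_n}) :
    \sum_u marginal Z (prefix_set sg (sg u)) u = H Z.
  rewrite (eq_bigr (fun u =>
    info Z (prefix_set sg (sg u).+1) - info Z (prefix_set sg (sg u)))); last first.
    by move=> u _; rewrite -prefix_setS.
  pose d k := info Z (prefix_set sg k.+1) - info Z (prefix_set sg k).
  transitivity (\sum_(k < n) d k).
    by rewrite [RHS](reindex_inj (@perm_inj _ sg)).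
  rewrite -(big_mkord predT d) telescope_sumr //.
  have -> : prefix_set sg n = [set: 'I_n]%SET.
    by apply/setP => v; rewrite !inE ltn_ord.
  have -> : prefix_set sg 0 = finset.set0 by apply/setP => v; rewrite !inE.
  have setTE w w' : (coords [set: 'I_n]%SET w == coords [set: 'I_n]%SET w') = (w == w').
    by apply/coordsP/eqP => [E|->//]; apply/ffunP => i; apply: E.
  have set0E w w' : coords finset.set0 w == coords finset.set0 w'.
    by apply/coordsP => i; rewrite inE.
  have infoT : info Z [set: 'I_n]%SET = 0.
    apply/eqP; rewrite subr_eq0; apply/eqP/eq_rv_entropy => w w'.
    by rewrite xpair_eqE setTE; case: (w =P w') => [->|]; rewrite ?eqxx ?andbF.
  have info0 : info Z finset.set0 = - H Z.
    rewrite /info (_ : H (coords finset.set0) = 0); last first.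
      apply: big1 => w _; rewrite /level_mass (eq_bigl predT) ?iid_mass_sum1.
        by rewrite ln1 oppr0 mulr0.
      by move=> w'; apply: set0E.
    rewrite sub0r; congr (- _); apply: eq_rv_entropy => w w'.
    by rewrite xpair_eqE set0E andbT.
  by rewrite infoT info0 sub0r opprK.
rewrite -mulr_sumr exchange_big /= (eq_bigr (fun=> H Z)); last by move=> sg _.
by rewrite sumr_const -[H Z *+ _]mulr_natl mulKf // gt_eqF ?card_perm_gt0.
Qed.

(** The difference of the two sides is a conditional mutual information of [Z]
    and the seed [u], given [f \o Z] and the seeds in [B]. *)
Lemma le_marginal (T U : eqType) (Z : seeds -> T) (f : T -> U) B u :
  marginal (f \o Z) B u <= marginal Z B u.
Proof.
rewrite /marginal /info.
have := rv_entropy_submod iid_mass_ge0 Z (fun w => (f (Z w), coords B w))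
  (coords (u |: B)).
set h1 := H _; set h2 := H _; set h3 := H _; set h4 := H _.
have sub w w' : coords (u |: B) w == coords (u |: B) w' ->
    coords B w == coords B w'.
  by move/coordsP => E; apply/coordsP => i iB; apply: E; rewrite inE iB orbT.
have -> : h1 = H (fun w => (Z w, coords (u |: B) w)).
  apply: eq_rv_entropy => w w'; rewrite !xpair_eqE.
  case: eqP => //= ->; rewrite eqxx /=.
  by case: (boolP (coords (u |: B) w == _)) => [/sub->|]; rewrite ?andbF.
have -> : h3 = H (fun w => (Z w, coords B w)).
  apply: eq_rv_entropy => w w'; rewrite !xpair_eqE.
  by case: eqP => //= ->; rewrite eqxx.
have -> : h4 = H (fun w => (f (Z w), coords (u |: B) w)).
  apply: eq_rv_entropy => w w'; rewrite !xpair_eqE -andbA; congr andb.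
  by case: (boolP (coords (u |: B) w == _)) => [/sub->|]; rewrite ?andbF.
have -> : h2 = H (fun w => ((f \o Z) w, coords B w)) by [].
move: (H _) (H _) (H _) (H _) (H _) (H _) => a b c d e' g; lra.
Qed.

Lemma le_contrib (T U : eqType) (Z : seeds -> T) (f : T -> U) u :
  contrib (f \o Z) u <= contrib Z u.
Proof.
rewrite ler_pM2l ?invr_gt0 ?card_perm_gt0 //.
by apply: ler_sum => sg _; apply: le_marginal.
Qed.

Lemma marginal_ge0 (T : eqType) (Z : seeds -> T) B u : 0 <= marginal Z B u.
Proof.
apply: le_trans (le_marginal Z (fun=> tt) B u).
have info_tt C : info ((fun=> tt) \o Z) C = 0.
  by apply/eqP; rewrite subr_eq0; apply/eqP/eq_rv_entropy => w w'.
by rewrite /marginal !info_tt subrr.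
Qed.

Lemma contrib_ge0 (T : eqType) (Z : seeds -> T) u : 0 <= contrib Z u.
Proof.
rewrite mulr_ge0 ?invr_ge0 ?ler0n // sumr_ge0 // => sg _.
exact: marginal_ge0.
Qed.

Lemma level_mass_coords (B : {set 'I_n}) w :
  level_mass iid_mass (coords B) w = \prod_(i in B) p (w i).
Proof.
(* The indicator of agreement with w on B is a product over the seeds. *)
pose F (i : 'I_n) a := if (i \in B) && (a != w i) then 0 else p a.
rewrite /level_mass big_mkcond (eq_bigr (fun w' : seeds => \prod_i F i (w' i))); last first.
  move=> w' _; case: coordsP => [E|nE].
    apply: eq_bigr => i _; rewrite /F; case: ifP => // /andP[/E->].
    by rewrite eqxx.
  have [i iB ne] : exists2 i, i \in B & w' i != w i.
    have [//|no] := pselect (exists2 i, i \in B & w' i != w i).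
    case: nE => i iB; apply/eqP; rewrite -[_ == _]negbK; apply/negP => ne.
    by apply: no; exists i.
  by rewrite (bigD1 i) //= /F iB ne mul0r.
rewrite -bigA_distr_bigA /= [RHS]big_mkcond; apply: eq_bigr => i _ /=.
rewrite /F; case: ifP => /= [_|_]; last exact: p1.
by rewrite (bigD1 (w i)) //= eqxx /= big1 ?addr0 // => a ->.
Qed.

Lemma rv_entropy_coordsU1 (B : {set 'I_n}) u : u \notin B ->
  H (coords (u |: B)) = H (coords B) + \sum_w iid_mass w * - ln (p (w u)).
Proof.
move=> uB; rewrite -big_split; apply: eq_bigr => w _ /=.
rewrite !level_mass_coords big_setU1 //= -mulrDr.
have [->|w0] := eqVneq (iid_mass w) 0; first by rewrite !mul0r.
have pw i : 0 < p (w i).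
  rewrite lt_def p0 andbT; move: w0; rewrite /iid_mass prodf_seq_neq0.
  by move/allP/(_ i (mem_index_enum i)).
by rewrite lnM ?posrE ?prodr_gt0 // opprD addrC.
Qed.

(** A seed on which [Z] does not depend contributes nothing: it is independent
    of all the seeds that determine [Z]. *)
Lemma contrib_eq0 (T : eqType) (Z : seeds -> T) (N : {set 'I_n}) u :
  (forall w w' : seeds, {in N, w =1 w'} -> Z w = Z w') -> u \notin N ->
  contrib Z u = 0.
Proof.
move=> ZN uN; rewrite /contrib big1 ?mulr0 // => sg _.
set B := prefix_set _ _.
have uB : u \notin B by rewrite inE ltnn.
(* Z is read off from the seeds in N, the others being given a default symbol. *)
have [a0 _] : exists a0 : A, true.
  have [a0 _|A0] := pickP (fun _ : A => true); first by exists a0.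
  by move: p1; rewrite big_pred0 // => /eqP; rewrite eq_sym oner_eq0.
pose f (x : {ffun 'I_n -> option A}) := Z [ffun i => odflt a0 (x i)].
have ZE : Z = f \o coords N.
  by apply/funext => w; apply: ZN => i iN; rewrite !ffunE iN.
have marginalN : marginal (coords N) B u = 0.
  have joint C : H (fun w => (coords N w, coords C w)) = H (coords (N :|: C)).
    apply: eq_rv_entropy => w w'; rewrite xpair_eqE.
    apply/andP/coordsP => [[/coordsP EN /coordsP EC] i|E].
      by rewrite inE => /orP[/EN|/EC].
    by split; apply/coordsP => i iC; apply: E; rewrite inE iC ?orbT.
  rewrite /marginal /info !joint finset.setUCA !rv_entropy_coordsU1 //; first by ring.
  by rewrite inE negb_or uN.
apply/eqP; rewrite eq_le marginal_ge0 andbT.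
by rewrite -marginalN ZE; apply: le_marginal.
Qed.

Definition permute (pi : {perm 'I_n}) (w : seeds) : seeds := [ffun i => w (pi i)].

Lemma permute_bij pi : bijective (permute pi).
Proof.
exists (permute pi^-1%g) => w; apply/ffunP => i; rewrite !ffunE.
  by rewrite permKV.
by rewrite permK.
Qed.

Lemma iid_mass_permute pi w : iid_mass (permute pi w) = iid_mass w.
Proof.
rewrite /iid_mass [RHS](reindex_inj (@perm_inj _ pi)).
by apply: eq_bigr => i _; rewrite ffunE.
Qed.

(** The seeds are identically distributed and the order in which they are
    revealed is uniform, so renaming them renames the shares. *)
Lemma contrib_permute (T : eqType) (Z : seeds -> T) pi u :
  contrib (Z \o permute pi) (pi u) = contrib Z u.
Proof.
have infoE (B : {set 'I_n}) : info (Z \o permute pi) (pi @: B) = info Z B.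
  have coordsE w w' : (coords (pi @: B) w == coords (pi @: B) w')
      = (coords B (permute pi w) == coords B (permute pi w')).
    apply/coordsP/coordsP => [E i iB|E _ /imsetP[i iB ->]].
      by rewrite !ffunE E ?imset_f.
    by have := E i iB; rewrite !ffunE.
  rewrite /info -(rv_entropy_comp (coords B) (permute_bij pi) (iid_mass_permute pi)).
  rewrite -(rv_entropy_comp (fun w => (Z w, coords B w)) (permute_bij pi)
    (iid_mass_permute pi)).
  by congr (_ - _); apply: eq_rv_entropy => w w'; rewrite ?xpair_eqE /= coordsE.
congr (_ * _); rewrite (reindex_inj (mulgI pi^-1%g)) /=.
apply: eq_bigr => sg _; rewrite permM permK.
have -> : prefix_set (pi^-1 * sg) (sg u) = pi @: prefix_set sg (sg u).
  apply/setP => v; rewrite inE permM -[v in RHS](permKV pi).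
  by rewrite mem_imset ?inE //; apply: perm_inj.
by rewrite /marginal -imsetU1 !infoE.
Qed.

End Shapley.

(** A partial injection of a finite set extends to a permutation: composing
    with a transposition corrects one more value without spoiling the others. *)
Lemma partial_injection_perm (T : finType) (N : seq T) (f : T -> T) :
  uniq N -> {in N &, injective f} ->
  exists pi : {perm T}, {in N, pi =1 f}.
Proof.
elim: N => [|x N IH] /=; first by exists 1%g.
move=> /andP[xN uN] f_inj; have [|pi piE] := IH uN.
  by move=> y z yN zN; apply: f_inj; rewrite inE ?yN ?zN orbT.
exists (pi * tperm (pi x) (f x))%g => y; rewrite inE permM.
have [->|yx] := eqVneq y x; first by rewrite tpermL.
move=> /= yN; rewrite (piE _ yN) tpermD //.
  by rewrite -(piE _ yN) (inj_eq perm_inj) eq_sym.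
apply/eqP => /f_inj E; move/eqP: yx; apply; apply/esym/E; rewrite inE ?eqxx //.
by rewrite yN orbT.
Qed.

(** The edge-vertex inequality for a label [b] that depends on the seeds in [N].
    The seeds are a finite set of group elements, which right multiplication by
    [s i] does not preserve; [pi i] is a permutation that agrees with it where it
    matters, on [N]. *)
Lemma edge_vertex_entropy_finite (R : realType) (G : groupType) (r : nat)
    (s : 'I_r -> G) (hG : free_basis s) (A : finType) (n : nat) (p : A -> R)
    (p0 : forall a, 0 <= p a) (p1 : \sum_a p a = 1)
    (e : 'I_n -> G) (e_inj : injective e) (N : {set 'I_n})
    (pi : 'I_r -> {perm 'I_n})
    (piE : forall i, {in N, forall k, e (pi i k) = (e k * s i)%g})
    (T : eqType) (b : {ffun 'I_n -> A} -> T)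
    (bN : forall w w' : {ffun 'I_n -> A}, {in N, w =1 w'} -> b w = b w') :
  2 * r%:R * rv_entropy (iid_mass p) b <=
    rv_entropy (iid_mass p) b + \sum_(i < r) rv_entropy (iid_mass p) (fun w => (b w, b (permute (pi i) w))).
Proof.
pose h := contrib p b; pose h' i := contrib p (b \o permute (pi i)).
have h0 u : 0 <= h u by apply: contrib_ge0.
pose gam g := \sum_(k < n) (e k == g)%:R * h k.
have gamE k : gam (e k) = h k.
  rewrite /gam (bigD1 k) //= eqxx mul1r big1 ?addr0 // => l lk.
  by rewrite (inj_eq e_inj) (negbTE lk) mul0r.
have gamS g : gam g != 0 -> exists k, e k = g.
  move=> g0; have [//|no] := pselect (exists k, e k = g).
  case/eqP: g0; apply: big1 => k _; case: eqP => [E|]; last by rewrite mul0r.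
  by case: no; exists k.
(* The seeds outside N, whose image under pi i is arbitrary, have share 0. *)
have h'E i u : h' i u = gam (e u * (s i)^-1)%g.
  rewrite -[u in LHS](permKV (pi i)) /h' contrib_permute // -/h.
  set v := (pi i)^-1%g u; have uE : u = pi i v by rewrite permKV.
  have [vN|vN] := boolP (v \in N); first by rewrite uE piE // mulgK gamE.
  rewrite [LHS](contrib_eq0 p0 p1 bN vN); apply/esym/eqP/negP => /negP gnz.
  have [k kE] := gamS _ gnz; move: gnz; rewrite -kE gamE => /eqP; apply.
  apply: (contrib_eq0 p0 p1 bN); apply: contra vN => kN.
  rewrite (_ : v = k) //; apply: (@perm_inj _ (pi i)); rewrite -uE.
  by apply: e_inj; rewrite piE // kE mulgKV.
have edge i : 2 * rv_entropy (iid_mass p) b - \sum_(k < n) Num.min (gam (e k)) (gam (e k * (s i)^-1)%g)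
    <= rv_entropy (iid_mass p) (fun w => (b w, b (permute (pi i) w))).
  rewrite -(sum_contrib p1 (fun w => (b w, b (permute (pi i) w)))).
  rewrite mulr_natl mulr2n -{1}(sum_contrib p1 b).
  rewrite -(rv_entropy_comp b (permute_bij A (pi i))
    (iid_mass_permute p (pi i))).
  rewrite -(sum_contrib p1 (b \o _)) -big_split -sumrB; apply: ler_sum => u _ /=.
  rewrite -/(h u) -/(h' i u) h'E gamE -(addr_max_min (h u)) addrK ge_max -h'E.
  have c1 : h u <= contrib p (fun w => (b w, b (permute (pi i) w))) u.
    exact: (le_contrib p0 (fun w => (b w, b (permute (pi i) w))) fst u).
  rewrite c1; exact: (le_contrib p0 (fun w => (b w, b (permute (pi i) w))) snd u).
have := sum_edge_min_le hG e_inj (gam := gam).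
have -> : \sum_(k < n) gam (e k) = rv_entropy (iid_mass p) b.
  by rewrite (eq_bigr _ (fun k _ => gamE k)) sum_contrib.
move=> /(_ _ gamS) tree.
have {}tree := tree (fun g => sumr_ge0 _ (fun k _ => mulr_ge0 (ler0n _ _) (h0 k))).
have : \sum_(i < r) (2 * rv_entropy (iid_mass p) b -
      \sum_(k < n) Num.min (gam (e k)) (gam (e k * (s i)^-1)%g)) <=
    \sum_(i < r) rv_entropy (iid_mass p) (fun w => (b w, b (permute (pi i) w))).
  by apply: ler_sum.
rewrite sumrB sumr_const card_ord -[(2 * _) *+ r]mulr_natl => sum_edge.
set S := \sum_(i < r) rv_entropy (iid_mass p) _ in sum_edge *.
by move: tree sum_edge; set m := \sum_(i < r) _; lra.
Qed.

(** * Entropy of finite-valued labels on a probability space *)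

Section LabelEntropy.
Context {R : realType} {d : measure_display} {Om : measurableType d}.
Variable mu : probability Om R.

Definition eta (x : R) : R := - (x * ln x).

Definition label_mass (T : eqType) (X : Om -> T) (t : T) : R :=
  fine (mu [set x | X x = t]).

Definition label_entropy (T : finType) (X : Om -> T) : R :=
  \sum_t eta (label_mass X t).

Definition measurable_label (T : eqType) (X : Om -> T) : Prop :=
  forall t, measurable [set x | X x = t].

Lemma label_preimageE (T : finType) (X : Om -> T) (P : pred T) :
  [set x | P (X x)] = \bigcup_(t in [set t | P t]) [set x | X x = t].
Proof. by apply/seteqP; split=> [x Px|x [t Pt /= ->]] //; exists (X x). Qed.

Lemma measurable_label_preimage (T : finType) (X : Om -> T) (P : pred T) :
  measurable_label X -> measurable [set x | P (X x)].
Proof.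
move=> mX; rewrite label_preimageE.
by apply: fin_bigcup_measurable => [|t _]; [exact: finite_finset | exact: mX].
Qed.

Lemma mu_label_preimage (T : finType) (X : Om -> T) (P : pred T) :
  measurable_label X ->
  mu [set x | P (X x)] = (\sum_(t | P t) label_mass X t)%:E.
Proof.
move=> mX; rewrite label_preimageE measure_fin_bigcup.
- set l := [seq t <- enum T | P t].
  have lU : uniq l by rewrite filter_uniq ?enum_uniq.
  rewrite (_ : [set t | P t] = [set` l]); last first.
    by apply/seteqP; split=> t /=; rewrite mem_filter mem_enum ?andbT.
  apply: etrans (esym (fsbig_seq _ _ lU)) _.
  rewrite big_filter big_enum_cond /= -sumEFin; apply: eq_bigr => t _.
  by rewrite fineK ?fin_num_measure //; apply: mX.
- exact: finite_finset.
- by move=> t u _ _ [x [/= <- <-]].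
- by move=> t _; apply: mX.
Qed.

Lemma sum_label_mass (T : finType) (X : Om -> T) :
  measurable_label X -> \sum_t label_mass X t = 1.
Proof.
move=> mX; have := mu_label_preimage predT mX.
rewrite (_ : [set x | predT (X x)] = [set: Om]); last by apply/seteqP; split.
by rewrite probability_setT => -[].
Qed.

Lemma probability_inhabited : exists x : Om, True.
Proof.
apply/not_existsP => no; have := @probability_setT _ _ _ mu.
rewrite (_ : setT = set0) ?measure0.
  by move=> [] /eqP; rewrite eq_sym oner_eq0.
by apply/seteqP; split=> x // _; exact: (no x).
Qed.

(** A label that factors through a finite-valued one has the same entropy as on
    the finite probability space of its values. *)
Lemma label_entropy_comp (T : finType) (Z : Om -> T) (U : finType)
    (f : T -> U) : measurable_label Z ->
  label_entropy (f \o Z) = rv_entropy (label_mass Z) f.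
Proof.
move=> mZ; have massE u : label_mass (f \o Z) u = \sum_(t | f t == u) label_mass Z t.
  rewrite {1}/label_mass (_ : [set _ | _] = [set x | f (Z x) == u]).
    by rewrite (mu_label_preimage (fun t => f t == u)).
  by apply/seteqP; split=> x /= /eqP.
rewrite /rv_entropy (partition_big f predT) //=; apply: eq_bigr => u _.
rewrite massE /eta -mulrN mulr_suml; apply: eq_bigr => t /eqP tu.
by congr (_ * - ln _); rewrite /level_mass tu.
Qed.

Lemma label_mass_ge0 (T : eqType) (X : Om -> T) t : 0 <= label_mass X t.
Proof. by rewrite fine_ge0. Qed.

Lemma label_mass_le1 (T : eqType) (X : Om -> T) t :
  measurable_label X -> label_mass X t <= 1.
Proof.
by move=> mX; rewrite -lee_fin fineK ?fin_num_measure ?probability_le1 //; apply: mX.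
Qed.

Lemma eta_ge0 (x : R) : x <= 1 -> 0 <= eta x.
Proof.
have [x0 _|x0 x1] := leP x 0; first by rewrite /eta ln0 // mulr0 oppr0.
by rewrite /eta -mulrN mulr_ge0 ?(ltW x0) // oppr_ge0 ln_le0.
Qed.

(** From [ln z <= z] at the inverse of the square root of [x]; it gives the
    continuity of [eta] at 0. *)
Lemma eta_le_sqrt (x : R) : 0 < x -> eta x <= 2 * Num.sqrt x.
Proof.
move=> x0; set y := Num.sqrt x; have y0 : 0 < y by rewrite sqrtr_gt0.
have -> : x = y ^+ 2 by rewrite sqr_sqrtr // ltW.
rewrite /eta lnXn // -mulrN -mulNrn -lnV ?posrE //.
have := ln_sublinear (x := y^-1); rewrite invr_gt0 => /(_ y0)/ltW le.
rewrite -[_ *+ 2]mulr_natl mulrCA ler_wpM2l //.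
apply: (@le_trans _ _ (y ^+ 2 * y^-1)); first by rewrite ler_wpM2l ?sqr_ge0.
by rewrite expr2 mulfK ?gt_eqF.
Qed.

(** At 0 this relies on the convention that [ln] vanishes on nonpositive
    numbers. *)
Lemma continuous_eta : continuous eta.
Proof.
move=> x; have [x0|x0|->] := ltgtP x 0.
- apply: (@near_cst_continuous _ _ 0); near=> y.
  have y0 : y < 0 by near: y; exact: lt_nbhsl.
  by rewrite /eta ln0 ?(ltW y0) // mulr0 oppr0.
- by apply: cvgN; apply: cvgM; [exact: cvg_id | exact: continuous_ln].
rewrite /continuous_at /eta mul0r oppr0.
apply: (@squeeze_cvgr _ _ _ _ (fun=> 0) (fun y => 2 * Num.sqrt `|y|)).
- near=> y; have y1 : y < 1 by near: y; exact: lt_nbhsl.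
  have [y0|y0] := leP y 0.
    by rewrite -/(eta y) /eta ln0 // mulr0 oppr0 lexx mulr_ge0 ?sqrtr_ge0.
  by rewrite -/(eta y) eta_ge0 ?(ltW y1) // gtr0_norm // eta_le_sqrt.
- exact: cvg_cst.
have c : {for 0, continuous (fun y : R => Num.sqrt `|y|)}.
  by apply: continuous_comp; [exact: norm_continuous | exact: sqrt_continuous].
have := cvgM (cvg_cst (2 : R)) c; rewrite normr0 sqrtr0 mulr0; exact.
Unshelve. all: by end_near. Qed.

End LabelEntropy.

(** * Local labels of a Bernoulli shift *)

Section Bernoulli.
Context {R : realType} {G : groupType} {dK : measure_display}
  {K : measurableType dK}.
Variables (kappa : probability K R) (mu : probability (config G K) R).
Hypothesis hmu : is_product_measure kappa mu.

Definition window (n : nat) (e : 'I_n -> G) (A : finType) (c : K -> A)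
    (x : config G K) : {ffun 'I_n -> A} := [ffun k => c (x (e k))].

(** Besides looking at finitely many coordinates, a local label sees only
    finitely many classes of symbols, so it lives on a finite probability
    space whatever [K] is. *)
Definition local_label (T : Type) (X : config G K -> T) : Prop :=
  exists (A : finType) (c : K -> A) (D : seq G),
    measurable_label c /\
    forall x y : config G K, {in D, forall g, c (x g) = c (y g)} -> X x = X y.

Lemma measurable_coordinate (g : G) (A : set K) :
  measurable A -> measurable [set x : config G K | A (x g)].
Proof. by move=> mA; apply: sub_sigma_algebra; exists g, A. Qed.

Lemma measurable_window n (e : 'I_n -> G) (A : finType) (c : K -> A) :
  measurable_label c -> measurable_label (window e c).
Proof.
move=> mc w; rewrite (_ : [set x | _] =
    \bigcap_(k in [set: 'I_n]) [set x : config G K | c (x (e k)) = w k]).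
  apply: fin_bigcap_measurable => [|k _]; first exact: finite_finset.
  exact: (measurable_coordinate (e k) (mc (w k))).
apply/seteqP; split=> [x /= <- k _|x E] /=; first by rewrite ffunE.
by apply/ffunP => k; rewrite ffunE E.
Qed.

Lemma label_mass_window n (e : 'I_n -> G) (A : finType) (c : K -> A) w :
  injective e -> measurable_label c ->
  label_mass mu (window e c) w = iid_mass (label_mass kappa c) w.
Proof.
move=> e_inj mc; pose B g : set K :=
  if [pick k | e k == g] is Some k then [set a | c a = w k] else setT.
have Be k : B (e k) = [set a | c a = w k].
  rewrite /B; case: pickP => [l /eqP/e_inj->//|/(_ k)]; by rewrite eqxx.
have mB g : measurable (B g) by rewrite /B; case: pickP => // k _; exact: mc.
have := hmu (D := [seq e k | k <- enum 'I_n]) _ mB.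
rewrite map_inj_uniq ?enum_uniq // => /(_ isT).
rewrite big_map big_enum /= => E; rewrite /label_mass.
rewrite (_ : [set x | _] = [set x | forall g, g \in [seq e k | k <- enum 'I_n] ->
    B g (x g)]); last first.
  apply/seteqP; split=> [x /= xw _ /mapP[k _ ->]|x Bx] /=.
    by rewrite Be /= -xw ffunE.
  apply/ffunP => k; rewrite ffunE.
  by have := Bx (e k); rewrite Be map_f ?mem_enum //; apply.
rewrite E; under eq_bigr do rewrite Be -(fineK (fin_num_measure _ _ (mc _))).
by rewrite prodEFin.
Qed.

Local Notation shift := (@bernoulli_shift G dK K).

(** The label at the vertex [s i] reads the seeds [g * s i], for [g] read at the
    identity, so the window [I] contains both sets of seeds. *)
Lemma local_edge_vertex_entropy (r : nat) (s : 'I_r -> G) (hG : free_basis s)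
    (T : finType) (X : config G K -> T) (hX : local_label X) :
  2 * r%:R * label_entropy mu X <= label_entropy mu X +
    \sum_(i < r) label_entropy mu (fun x => (X x, X (shift (s i) x))).
Proof.
case: hX => A [c [D [mc XD]]].
have [x0 _] := probability_inhabited mu.
pose I := undup (D ++ [seq (g * s i)%g | g <- D, i <- enum 'I_r]).
pose e (k : 'I_(size I)) := nth 1%g I k.
have e_inj : injective e.
  by move=> k l /eqP; rewrite nth_uniq ?undup_uniq // => /eqP/val_inj.
have eI g : g \in I -> exists k, e k = g.
  by move=> gI; exists (Ordinal (etrans (index_mem g I) gI)); rewrite /e /= nth_index.
pose N := [set k | e k \in D]%SET.
have pi_ex i : exists pi : {perm 'I_(size I)},
    {in N, forall k, e (pi k) = (e k * s i)%g}.
  have [f fE] : exists f : 'I_(size I) -> 'I_(size I),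
      {in N, forall k, e (f k) = (e k * s i)%g}.
    have /choice[f fE] : forall k, exists l, k \in N -> e l = (e k * s i)%g.
      move=> k; have [kN|kN] := boolP (k \in N); last by exists k.
      have [|l lE] := eI (e k * s i)%g; last by exists l.
      rewrite mem_undup mem_cat; apply/orP; right.
      by apply/allpairsP; exists (e k, i); rewrite mem_enum; move: kN; rewrite inE.
    by exists f => k kN; apply: fE.
  have [||pi piE] := @partial_injection_perm _ (enum N) f.
  - exact: enum_uniq.
  - move=> k l; rewrite !mem_enum => kN lN /(congr1 e); rewrite !fE //.
    by move=> /mulIg/e_inj.
  by exists pi => k kN; rewrite piE ?mem_enum ?fE.
have /choice[pi piE] := pi_ex.
(* X as a function of the classes seen in the window: evaluate X at any point
   that shows the prescribed classes on N, or at x0 if no point does. *)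
pose b (w : {ffun 'I_(size I) -> A}) : T :=
  X (xget x0 [set x : config G K | {in N, forall k, c (x (e k)) = w k}]).
have bN (w w' : {ffun 'I_(size I) -> A}) : {in N, w =1 w'} -> b w = b w'.
  move=> E; congr (X (xget _ _)); apply/seteqP; split=> x xw k kN.
    by rewrite xw ?E.
  by rewrite xw ?E.
have Xb x (w : {ffun 'I_(size I) -> A}) :
    {in N, forall k, c (x (e k)) = w k} -> X x = b w.
  move=> xw; rewrite /b; case: xgetP => [y _ yw|/(_ x)//].
  apply: XD => g gD; have [|k kE] := eI g; first by rewrite mem_undup mem_cat gD.
  have kN : k \in N by rewrite inE kE.
  by rewrite -kE xw ?yw.
have mW := measurable_window e mc.
have XE : X = b \o window e c.
  by apply/funext => x; apply: Xb => k _; rewrite ffunE.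
have XiE i : (fun x => (X x, X (shift (s i) x))) =
    (fun w => (b w, b (permute (pi i) w))) \o window e c.
  apply/funext => x; congr (_, _); first by rewrite XE.
  apply: Xb => k kN; rewrite /bernoulli_shift !ffunE.
  by rewrite (piE i k kN).
have mE : label_mass mu (window e c) = iid_mass (label_mass kappa c).
  by apply/funext => w; apply: label_mass_window.
under eq_bigr do rewrite XiE label_entropy_comp // mE.
rewrite {1 2}XE !label_entropy_comp // mE.
exact: (edge_vertex_entropy_finite hG (label_mass_ge0 kappa c)
  (sum_label_mass kappa mc) e_inj piE bN).
Qed.

End Bernoulli.

(** * From local labels to all labels *)

Section LabelLimit.
Context {R : realType} {d : measure_display} {Om : measurableType d}.
Variable mu : probability Om R.

Lemma label_mass_dist (T : eqType) (X X' : Om -> T) (E : set Om) t :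
  measurable_label X -> measurable_label X' -> measurable E ->
  (forall x, ~ E x -> X x = X' x) ->
  `|label_mass mu X t - label_mass mu X' t| <= fine (mu E).
Proof.
have le (Y Z : Om -> T) : measurable_label Y -> measurable_label Z ->
    measurable E -> (forall x, ~ E x -> Y x = Z x) ->
    label_mass mu Y t - label_mass mu Z t <= fine (mu E).
  move=> mY mZ mE YZ; rewrite lerBlDl /label_mass.
  rewrite -lee_fin EFinD !fineK ?fin_num_measure //; try by [exact: mZ|exact: mY].
  apply: le_trans (measureU2 mu (mZ t) mE); apply: le_measure; rewrite ?inE.
  - exact: mY.
  - by apply: measurableU => //; exact: mZ.
  - move=> x /= Yx; have [Ex|/YZ <-] := pselect (E x); [by right | by left].
move=> mX mX' mE XX'; rewrite ler_norml le // andbT lerNl opprB le // => x Ex.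
by rewrite XX'.
Qed.

(** Entropy is continuous for labels that differ on sets of small measure. *)
Lemma label_entropy_cvg (T : finType) (X : Om -> T) (Xn : nat -> Om -> T)
    (E : nat -> set Om) :
  measurable_label X -> (forall n, measurable_label (Xn n)) ->
  (forall n, measurable (E n)) -> (forall n x, ~ E n x -> Xn n x = X x) ->
  fine (mu (E n)) @[n --> \oo] --> (0 : R) ->
  label_entropy mu (Xn n) @[n --> \oo] --> label_entropy mu X.
Proof.
move=> mX mXn mE XnX E0.
have -> : (fun n => label_entropy mu (Xn n)) =
    (fun n => \sum_t eta (label_mass mu (Xn n) t)) by [].
apply: cvg_big => [|t _]; first exact: add_continuous.
apply: continuous_cvg; first exact: continuous_eta.
apply/cvgrPdist_le => e e0.
have /cvgrPdist_le/(_ _ e0) := E0; apply: filterS => n; rewrite sub0r normrN.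
rewrite ger0_norm ?fine_ge0 //; apply: le_trans.
by apply: label_mass_dist => // x /XnX.
Qed.

End LabelLimit.

Section BernoulliLabels.
Context {R : realType} {G : groupType} {dK : measure_display}
  {K : measurableType dK}.
Variables (kappa : probability K R) (mu : probability (config G K) R).
Hypothesis hmu : is_product_measure kappa mu.

Local Notation shift := (@bernoulli_shift G dK K).

Lemma measurable_local_label (T : finType) (X : config G K -> T) :
  local_label X -> measurable_label X.
Proof.
move=> [A [c [D [mc XD]]]] t; pose e (k : 'I_(size D)) := nth 1%g D k.
rewrite (_ : [set x | X x = t] = [set x | `[<exists2 y, X y = t &
    window e c y = window e c x>]]); last first.
  apply/seteqP; split=> [x xt|x /asboolP[y <- /ffunP yx]] /=.
    by apply/asboolP; exists x.
  apply: XD => g /(nthP 1%g)[i iD <-].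
  by have := yx (Ordinal iD); rewrite !ffunE.
exact: (measurable_label_preimage
  (fun w => `[<exists2 y, X y = t & window e c y = w>]) (measurable_window e mc)).
Qed.

Lemma measurable_shift g : measurable_fun setT (shift g).
Proof.
apply: (@measurability _ _ _ (config G K) setT (shift g) (@cylinders G dK K)) => //.
move=> _ [_ [h [A [mA ->]]] <-]; rewrite setTI.
exact: (measurable_coordinate (h * g)%g mA).
Qed.

(** By uniqueness of measures on the pi-system of finite-dimensional
    cylinders. *)
Lemma shift_invariant g (A : set (config G K)) :
  measurable A -> mu (shift g @^-1` A) = mu A.
Proof.
pose cyl : set_system (config G K) := [set C | exists (D : seq G) (B : G -> set K),
  [/\ uniq D, forall h, measurable (B h) &
      C = [set x | forall h, h \in D -> B h (x h)]]].
pose nu := measure_function_pushforward__canonical__measure_function_Measure mu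
  (measurable_shift g).
have gen : measurable = <<s cyl >>.
  apply/seteqP; split; apply: smallest_sub => //; try exact: smallest_sigma_algebra.
    move=> _ [h [B [mB ->]]]; apply: sub_sigma_algebra.
    exists [:: h], (fun=> B); split=> //; apply/seteqP; split=> x /=.
      by move=> Bx k; rewrite inE => /eqP->.
    by apply; rewrite inE.
  move=> _ [D [B [_ mB ->]]].
  rewrite (_ : [set x | _] = \bigcap_(h in [set` D]) [set x : config G K | B h (x h)]).
    apply: fin_bigcap_measurable => [|h _]; first exact: finite_seq.
    exact: measurable_coordinate.
  by apply/seteqP; split.
apply: (measure_unique cyl (fun=> setT) gen _ _ _ nu mu).
- move=> _ _ [D1 [B1 [_ mB1 ->]]] [D2 [B2 [_ mB2 ->]]].
  exists (undup (D1 ++ D2)), (fun h => (if h \in D1 then B1 h else setT) `&`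
    (if h \in D2 then B2 h else setT)); split; first exact: undup_uniq.
    by move=> h; apply: measurableI; case: ifP.
  apply/seteqP; split=> [x [x1 x2] h|x xB] /=.
    by rewrite mem_undup mem_cat => _; split; case: ifP => // ?; [exact: x1|exact: x2].
  by split=> h hD; have := xB h; rewrite mem_undup mem_cat hD ?orbT => /(_ isT) [].
- move=> _; exists [::], (fun=> setT); split=> //.
  by apply/seteqP; split=> x.
- by apply/seteqP; split=> // x _; exists 0%N.
- move=> _ [D [B [uD mB ->]]].
  have -> : nu [set x | forall h, h \in D -> B h (x h)] =
      mu [set x | forall k, k \in [seq (h * g)%g | h <- D] -> B (k * g^-1)%g (x k)].
    congr (mu _); apply/seteqP; split=> x /= xB.
      by move=> _ /mapP[h hD ->]; rewrite mulgK; apply: xB.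
    by move=> h hD; have := xB (h * g)%g; rewrite mulgK; apply; apply: map_f.
  have uDg : uniq [seq (h * g)%g | h <- D].
    by rewrite map_inj_uniq //; apply: mulIg.
  apply: etrans (esym (hmu uD mB)).
  apply: (etrans (hmu uDg (A := fun k => B (k * g^-1)%g) _)) => //.
  by rewrite big_map; apply: eq_bigr => h _; rewrite mulgK.
- by move=> _; apply: le_lt_trans (probability_le1 mu measurableT) (ltry _).
Qed.

(** The error is bounded through an exceptional set, instead of a symmetric
    difference: such sets can be united, and pulled back by the shift. *)
Definition locally_approximable (A : set (config G K)) : Prop :=
  forall eps : R, 0 < eps -> exists (L : config G K -> bool) (E : set (config G K)),
    [/\ local_label L, measurable E, (mu E < eps%:E)%E &
        forall x, ~ E x -> (A x <-> L x)].

Lemma local_label_cst (T : Type) (t : T) : local_label (fun _ : config G K => t).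
Proof.
exists unit, (fun=> tt), [::]; split=> // -[].
by rewrite (_ : [set _ | _] = setT) //; apply/seteqP; split.
Qed.

Lemma local_label_comp2 (T U V : Type) (X : config G K -> T)
    (Y : config G K -> U) (f : T -> U -> V) :
  local_label X -> local_label Y -> local_label (fun x => f (X x) (Y x)).
Proof.
move=> [A [a [D [ma XD]]]] [B [b [D' [mb YD]]]].
exists (A * B)%type, (fun k => (a k, b k)), (D ++ D'); split.
  move=> [u v]; rewrite (_ : [set _ | _] = [set k | a k = u] `&` [set k | b k = v]).
    by apply: measurableI; [exact: ma | exact: mb].
  by apply/seteqP; split=> k /= [-> ->].
move=> x y xy; congr (f _ _).
  by apply: XD => g gD; have := xy g; rewrite mem_cat gD => /(_ isT) [].
by apply: YD => g gD; have := xy g; rewrite mem_cat gD orbT => /(_ isT) [].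
Qed.

Lemma locally_approximableU A B : locally_approximable A ->
  locally_approximable B -> locally_approximable (A `|` B).
Proof.
move=> aA aB eps e0; have e20 : 0 < eps / 2 by rewrite divr_gt0.
have [L [E [lL mE Ee AL]]] := aA _ e20; have [M [F [lM mF Fe BM]]] := aB _ e20.
exists (fun x => L x || M x), (E `|` F); split.
- exact: local_label_comp2.
- exact: measurableU.
- apply: le_lt_trans (measureU2 mu mE mF) _.
  by rewrite [eps]splitr EFinD; apply: lteD.
- move=> x /not_orP[/AL xA /BM xB]; split=> [[/xA->|/xB->]|/orP[/xA|/xB]].
  + by [].
  + by rewrite orbT.
  + by left.
  + by right.
Qed.

(** A countable union is almost exhausted by a finite one. *)
Lemma locally_approximable_bigcup (F : nat -> set (config G K)) :
  (forall n, measurable (F n)) -> (forall n, locally_approximable (F n)) ->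
  locally_approximable (\bigcup_n F n).
Proof.
move=> mF aF eps e0; have e20 : 0 < eps / 2 by rewrite divr_gt0.
pose U n := \big[setU/set0]_(i < n) F i.
have mU n : measurable (U n) by apply: bigsetU_measurable.
have aU n : locally_approximable (U n).
  elim: n => [|n IH]; last by rewrite /U big_ord_recr; apply: locally_approximableU.
  rewrite /U big_ord0 => ep ep0; exists (fun=> false), set0; split=> //.
  - exact: local_label_cst.
  - by rewrite measure0.
have mB : measurable (\bigcup_n F n) by apply: bigcup_measurable.
pose rest n := \bigcup_n F n `\` U n.
have mrest n : measurable (rest n) by apply: measurableD.
have rest0 : \bigcap_n rest n = set0.
  apply/seteqP; split=> // x xr; have [[n _ xn] _] := xr 0%N I.
  have [_] := xr n.+1 I; apply; rewrite /U -bigcup_mkord.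
  by exists n => //=.
have := @nonincreasing_cvg_mu _ _ _ mu rest _ mrest.
rewrite rest0 measure0 => /(_ _ measurable0) cvg_rest.
have [n rn] : exists n, (mu (rest n) < (eps / 2)%:E)%E.
  have /cvg_rest : ereal_nbhs (0%:E : \bar R) (fun u => (u < (eps / 2)%:E)%E).
    by apply: open_ereal_lt'; rewrite lte_fin.
  case.
  - exact: le_lt_trans (probability_le1 mu (mrest _)) (ltry _).
  - move=> m n mn; apply/subsetPset; apply: setDS; rewrite /U -!bigcup_mkord.
    by apply: bigcup_sub => i /= im; apply: bigcup_sup => /=; apply: leq_trans mn.
  - by move=> N _ /(_ N) rN; exists N; apply: rN => /=.
have [L [E [lL mE Ee UL]]] := aU n _ e20.
exists L, (E `|` rest n); split=> //; first exact: measurableU.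
  apply: le_lt_trans (measureU2 mu mE (mrest n)) _.
  by rewrite [eps]splitr EFinD; apply: lteD.
move=> x /not_orP[/UL xU xr]; rewrite -xU; split=> [xF|].
  by apply: contrapT => nU; apply: xr.
by rewrite /U -bigcup_mkord => -[i _ xi]; exists i.
Qed.

(** The approximable measurable sets form a sigma-algebra, and a one-coordinate
    cylinder is itself a local label, with the symbols split into two classes. *)
Lemma measurable_locally_approximable A :
  measurable A -> locally_approximable A.
Proof.
suff: @measurable _ (config G K) `<=` [set B | measurable B /\ locally_approximable B].
  by move=> sub /sub[].
apply: smallest_sub; last first.
  move=> _ [g [B [mB ->]]]; split; first exact: measurable_coordinate.
  move=> eps e0; exists (fun x => `[<B (x g)>]), set0; split=> //.
  - exists bool, (fun k => `[<B k>]), [:: g]; split.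
      case.
      + rewrite (_ : [set _ | _] = B) //.
        by apply/seteqP; split=> k /= /asboolP.
      + rewrite (_ : [set _ | _] = ~` B); first exact: measurableC.
        by apply/seteqP; split=> k /=; [move/negbT/asboolPn | move/asboolPn/negbTE].
    by move=> x y /(_ g); rewrite inE; apply.
  - by rewrite measure0.
  - by move=> x _; split=> /asboolP.
split.
- split=> // eps e0; exists (fun=> false), set0; split=> //.
  + exact: local_label_cst.
  + by rewrite measure0.
- move=> B [mB aB]; rewrite setTD; split; first exact: measurableC.
  move=> eps e0; have [L [E [lL mE Ee BL]]] := aB _ e0.
  exists (fun x => ~~ L x), E; split=> //.
    exact: (local_label_comp2 (fun u _ => ~~ u) lL lL).
  by move=> x /BL xB; split=> [/= nB|/negP nL]; [apply/negP => /xB | move=> /xB].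
- move=> F aF; split; first by apply: bigcup_measurable => n _; case: (aF n).
  by apply: locally_approximable_bigcup => n; case: (aF n).
Qed.

Lemma local_label_approx (T : finType) (X : config G K -> T) (eps : R) :
  measurable_label X -> 0 < eps ->
  exists (X' : config G K -> T) (E : set (config G K)),
    [/\ local_label X', measurable E, (mu E < eps%:E)%E &
        forall x, ~ E x -> X' x = X x].
Proof.
move=> mX e0; have [x0 _] := probability_inhabited mu.
(* Approximate the events X = t one value t at a time. *)
suff approx (l : seq T) : forall eps, 0 < eps ->
    exists (X' : config G K -> option T) (E : set (config G K)),
    [/\ local_label X', measurable E, (mu E < eps%:E)%E &
        forall x, ~ E x -> X' x = if X x \in l then Some (X x) else None].
  have [X' [E [lX' mE Ee X'E]]] := approx (enum T) _ e0.
  exists (fun x => odflt (X x0) (X' x)), E; split=> //.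
    exact: (local_label_comp2 (fun o _ => odflt (X x0) o) lX' lX').
  by move=> x /X'E ->; rewrite mem_enum.
elim: l {eps e0} => [|t l IH] eps e0.
  exists (fun=> None), set0; split=> //; first exact: local_label_cst.
  by rewrite measure0.
have e20 : 0 < eps / 2 by rewrite divr_gt0.
have [X' [E [lX' mE Ee X'E]]] := IH _ e20.
have [L [F [lL mF Fe LF]]] := measurable_locally_approximable (mX t) e20.
exists (fun x => if L x then Some t else X' x), (F `|` E); split.
- exact: (local_label_comp2 (fun b o => if b then Some t else o)).
- exact: measurableU.
- apply: le_lt_trans (measureU2 mu mF mE) _.
  by rewrite [eps]splitr EFinD; apply: lteD.
- move=> x /not_orP[/LF[/= Lt tL] /X'E ->]; rewrite inE.
  have [Xt|Xt] := eqVneq (X x) t; first by rewrite Lt // Xt.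
  by case: ifP => // /tL; move/eqP: Xt.
Qed.

Lemma measurable_label_pair_shift (T : finType) (X : config G K -> T) g :
  measurable_label X -> measurable_label (fun x => (X x, X (shift g x))).
Proof.
move=> mX [t u]; rewrite (_ : [set x | _] =
    [set x | X x = t] `&` (shift g @^-1` [set x | X x = u])).
  apply: measurableI; first exact: mX.
  by rewrite -[X in measurable X]setTI; apply: measurable_shift => //; exact: mX.
by apply/seteqP; split=> x /= [-> ->].
Qed.

Lemma bernoulli_edge_vertex_entropy (r : nat) (s : 'I_r -> G)
    (hG : free_basis s) (T : finType) (X : config G K -> T) :
  measurable_label X ->
  2 * r%:R * label_entropy mu X <= label_entropy mu X +
    \sum_(i < r) label_entropy mu (fun x => (X x, X (shift (s i) x))).
Proof.
move=> mX.
have /choice[Xn] : forall n, exists X' : config G K -> T, exists E,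
    [/\ local_label X', measurable E, (mu E < (n.+1%:R^-1)%:E)%E &
        forall x, ~ E x -> X' x = X x].
  by move=> n; apply: local_label_approx.
move=> /choice[E XnE].
have lX n : local_label (Xn n) by case: (XnE n).
have mE n : measurable (E n) by case: (XnE n).
have Ee n : fine (mu (E n)) <= n.+1%:R^-1.
  by case: (XnE n) => _ _ /ltW En _; rewrite -lee_fin fineK ?fin_num_measure.
have XE n x : ~ E n x -> Xn n x = X x by case: (XnE n) => _ _ _; apply.
have mXn n : measurable_label (Xn n) by apply: measurable_local_label.
have cvg_vertex : label_entropy mu (Xn n) @[n --> \oo] --> label_entropy mu X.
  apply: (label_entropy_cvg mX mXn mE XE).
  apply: (@squeeze_cvgr _ _ _ _ (fun=> 0) harmonic).
  - by near=> n; rewrite fine_ge0 ?Ee.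
  - exact: cvg_cst.
  - exact: cvg_harmonic.
have cvg_edge i : label_entropy mu (fun x => (Xn n x, Xn n (shift (s i) x)))
    @[n --> \oo] --> label_entropy mu (fun x => (X x, X (shift (s i) x))).
  have mSE n : measurable (shift (s i) @^-1` E n).
    by rewrite -[X in measurable X]setTI; apply: measurable_shift.
  apply: (label_entropy_cvg (E := fun n => E n `|` shift (s i) @^-1` E n)).
  - exact: measurable_label_pair_shift.
  - by move=> n; apply: measurable_label_pair_shift.
  - by move=> n; apply: measurableU.
  - by move=> n x /not_orP[/XE -> /XE ->].
  apply: (@squeeze_cvgr _ _ _ _ (fun=> 0) (fun n => 2 * harmonic n)).
  - near=> n; rewrite fine_ge0 //= -lee_fin fineK; last first.
      by rewrite fin_num_measure //; apply: measurableU.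
    apply: (@le_trans _ _ (mu (E n) + mu (E n))%E).
      by rewrite -{2}(shift_invariant (s i) (mE n)); exact: measureU2.
    rewrite mulr_natl mulr2n EFinD.
    by rewrite -(fineK (fin_num_measure _ _ (mE n))) leeD ?lee_fin ?Ee.
  - exact: cvg_cst.
  - rewrite -[X in _ --> X](mulr0 2); apply: cvgM; first exact: cvg_cst.
    exact: cvg_harmonic.
apply: (@ler_cvg_to _ \oo _ _ (fun n => 2 * r%:R * label_entropy mu (Xn n))
  (fun n => label_entropy mu (Xn n) +
    \sum_(i < r) label_entropy mu (fun x => (Xn n x, Xn n (shift (s i) x))))).
- by apply: cvgM => //; exact: cvg_cst.
- apply: cvgD => //; apply: cvg_big => [|i _]; first exact: add_continuous.
  exact: cvg_edge.
- by near=> n; apply: (local_edge_vertex_entropy hmu hG (lX n)).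
Unshelve. all: by end_near. Qed.

End BernoulliLabels.

(** * Entropy of countable partitions *)

Section EsumExtra.
Context {R : realType}.
Local Open Scope ereal_scope.

Lemma esum_subset_le (T : choiceType) (P Q : set T) (a : T -> \bar R) :
  P `<=` Q -> \esum_(i in P) a i <= \esum_(i in Q) a i.
Proof.
move=> PQ; apply: ereal_sup_le => _ [F [fF FP] <-].
by exists F => //; split=> //; apply: subset_trans PQ.
Qed.

Lemma esum_image_le (T U : choiceType) (P : set T) (e : T -> U) (a : U -> \bar R) :
  \esum_(j in e @` P) a j <= \esum_(i in P) a (e i).
Proof.
have [->|/set0P[i0 _]] := eqVneq P set0; first by rewrite image_set0 !esum_set0.
have /choice[g gP] : forall j, exists i, (e @` P) j -> P i /\ e i = j.
  move=> j; have [[i Pi ij]|nj] := pselect ((e @` P) j); first by exists i.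
  by exists i0.
pose Q := g @` (e @` P).
have QP : Q `<=` P by move=> _ [j /gP[]] Pgj _ <-.
have eQ : e @` P = e @` Q.
  apply/seteqP; split=> [j Pj|_ [i /QP Pi <-]]; last by exists i.
  by exists (g j); [exists j | case: (gP j Pj)].
have Qinj : set_inj Q e.
  move=> i k /set_mem[j Pj <-] /set_mem[l Pl <-].
  by case: (gP j Pj) (gP l Pl) => _ -> [_ ->] ->.
by rewrite eQ esum_image //; apply: esum_subset_le.
Qed.

End EsumExtra.

Section Partitions.
Context {R : realType} {d : measure_display} {Y : measurableType d}.
Variable nu : probability Y R.

Lemma cell_eq (al : set_system Y) (P Q : set Y) y : countable_partition al ->
  al P -> al Q -> P y -> Q y -> P = Q.
Proof.
by move=> [_ _ /trivIsetP triv _] aP aQ Py Qy; apply: contrapT => /eqP PQ;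
  have : (P `&` Q) y by []; rewrite (triv P Q).
Qed.

Lemma cell_exists (al : set_system Y) y : countable_partition al ->
  exists2 P, al P & P y.
Proof. by case=> _ _ _ cov; have : setT y by []; rewrite -cov => -[P]; exists P. Qed.

Lemma bigcup_cells_measurable (al be : set_system Y) : countable_partition al ->
  be `<=` al -> measurable (\bigcup_(P in be) P).
Proof.
move=> [calp mal _ _] sub; rewrite bigcup_mkcond.
have [B /card_esym] := countable_bijP _ calp.
move=> /card_set_bijP[f fB].
rewrite (_ : \bigcup_i _ = \bigcup_(n in [set n | B n /\ be (f n)]) f n).
  by apply: bigcup_measurable => n [Bn bn]; apply/mal/sub.
rewrite -bigcup_mkcond; apply/seteqP; split=> [y [P bP Py]|y [n [Bn bn] fy]].
  have [_ _ /(_ P (sub _ bP))[n Bn nP]] := fB; exists n; last by rewrite nP.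
  by rewrite /= nP.
by exists (f n).
Qed.

(** Countable additivity over the cells. The factor [c], to be [- ln] of a mass,
    lets the terms of an entropy be regrouped. *)
Lemma esum_cells (al : set_system Y) (A : set Y) (c : R) :
  countable_partition al -> measurable A -> (0 <= c) ->
  (\esum_(P in al) (c%:E * nu (P `&` A)) = c%:E * nu A)%E.
Proof.
move=> [calp mal triv cov] mA c0.
have [B /card_esym] := countable_bijP _ calp.
move=> /card_set_bijP[f fB].
rewrite (reindex_esum B al f) //.
rewrite -[B in LHS]set_mem_set -nneseries_esum; last first.
  by move=> n _; rewrite mule_ge0 // lee_fin.
rewrite nneseriesZl; last by move=> n _.
have [fBal finj fsurj] := fB.
rewrite -measure_bigcup; last 2 first.
- by move=> n Bn; apply: measurableI => //; apply/mal/fBal.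
- apply/trivIsetP => i j Bi Bj ij; rewrite setIACA setIid.
  rewrite (_ : f i `&` f j = set0) ?set0I //.
  move/trivIsetP: triv; apply; [exact: fBal | exact: fBal |].
  by apply: contra ij => /eqP /finj ->; rewrite ?inE.
congr (_ * nu _)%E; apply/seteqP; split=> [y [n _ []]//|y Ay].
have : setT y by []; rewrite -cov => -[P aP Py].
by have [n Bn nP] := fsurj P aP; exists n => //; rewrite nP.
Qed.

Definition constant_on_cells (T : Type) (al : set_system Y) (Z : Y -> T) : Prop :=
  forall P, al P -> forall x y, P x -> P y -> Z x = Z y.

Lemma measurable_label_cells (T : eqType) (al : set_system Y) (Z : Y -> T) :
  countable_partition al -> constant_on_cells al Z -> measurable_label Z.
Proof.
move=> pal cZ t; rewrite (_ : [set y | Z y = t] =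
    \bigcup_(P in [set P | al P /\ P `<=` [set y | Z y = t]]) P).
  by apply: bigcup_cells_measurable pal _ => P [].
apply/seteqP; split=> [y /= yt|y [P [_ Pt] /Pt]//].
have [P aP Py] := cell_exists y pal; exists P => //; split=> // x Px /=.
by rewrite -yt; apply: (cZ _ aP).
Qed.

(** A label class has at least the mass of each cell inside it, hence a smaller
    [- ln] of its mass. *)
Lemma label_entropy_le (T : finType) (al : set_system Y) (Z : Y -> T) :
  countable_partition al -> constant_on_cells al Z ->
  ((label_entropy nu Z)%:E <= entropy nu al)%E.
Proof.
move=> pal cZ; have mZ := measurable_label_cells pal cZ.
pose c t := - ln (label_mass nu Z t).
have c0 t : 0 <= c t by rewrite oppr_ge0 ln_le0 // label_mass_le1.
rewrite /label_entropy -sumEFin (eq_bigr (fun t =>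
  \esum_(P in al) ((c t)%:E * nu (P `&` [set y | Z y = t]))%E)); last first.
  move=> t _; rewrite esum_cells // /eta -mulrN mulrC EFinM fineK //.
  by rewrite fin_num_measure //; apply: mZ.
rewrite -esum_sum; last by move=> P t _ _; rewrite mule_ge0 // lee_fin.
apply: le_esum => P aP; have mP : measurable P by case: pal => _ + _ _; apply.
have [P0|/set0P[y Py]] := eqVneq P set0.
  rewrite big1 => [|t _]; last by rewrite P0 set0I measure0 mule0.
  by rewrite P0 measure0 mul0r oppr0.
have PZ : P `<=` [set x | Z x = Z y] by move=> x Px; apply: (cZ _ aP).
rewrite (bigD1 (Z y)) //= big1 ?adde0 => [|t tZ]; last first.
  rewrite (_ : P `&` _ = set0) ?measure0 ?mule0 //.
  apply/seteqP; split=> x // [Px /= xt]; move/eqP: tZ; apply.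
  by rewrite -xt; apply: (cZ _ aP).
rewrite (_ : P `&` _ = P); last by apply/setIidl.
rewrite -[nu P in leLHS]fineK ?fin_num_measure // -EFinM lee_fin mulrC.
rewrite -mulrN.
have [Pgt0|Ple0] := ltP 0 (fine (nu P)); last first.
  by rewrite (_ : fine (nu P) = 0) ?mul0r //; apply/eqP; rewrite eq_le Ple0 fine_ge0.
rewrite ler_pM2l // lerN2 ler_ln ?posrE //.
  by rewrite fine_le ?fin_num_measure // ?le_measure ?inE //; exact: mZ.
apply: lt_le_trans Pgt0 _.
by rewrite fine_le ?fin_num_measure // ?le_measure ?inE //; exact: mZ.
Qed.

Lemma entropy_term_ge0 (P : set Y) : measurable P ->
  (0 <= (eta (fine (nu P)))%:E)%E.
Proof.
move=> mP; rewrite lee_fin eta_ge0 // -lee_fin fineK ?fin_num_measure //.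
exact: probability_le1.
Qed.

(** The label of a point is the position of its cell in [l]; the last label,
    [size l], stands for all the cells that are not listed. *)
Lemma cells_label (al : set_system Y) (l : seq (set Y)) :
  countable_partition al -> (forall P, P \in l -> al P) -> uniq l ->
  exists (T : finType) (Z : Y -> T), constant_on_cells al Z /\
    \sum_(P <- l) eta (fine (nu P)) <= label_entropy nu Z.
Proof.
move=> pal lal ul; pose pos y := find (fun P => `[<P y>]) l.
have pos_lt y : (pos y < (size l).+1)%N by rewrite ltnS find_size.
exists 'I_(size l).+1, (fun y => Ordinal (pos_lt y)).
have cZ : constant_on_cells al (fun y => Ordinal (pos_lt y)).
  move=> P aP x y Px Py; apply/val_inj => /=.
  apply: eq_in_find => Q /lal aQ; apply/asboolP/asboolP => [Qx|Qy].
    by rewrite (cell_eq pal aQ aP Qx Px).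
  by rewrite (cell_eq pal aQ aP Qy Py).
split=> //; have mZ := measurable_label_cells pal cZ.
rewrite /label_entropy big_ord_recr /= (big_nth set0) big_mkord.
rewrite -[leLHS]addr0 lerD //; last by rewrite eta_ge0 ?label_mass_le1.
apply: ler_sum => i _; rewrite /label_mass.
rewrite (_ : [set x | _] = nth set0 l i) //.
apply/seteqP; split=> [y /(congr1 val) /= yi|y yi].
  have : has (fun P => `[<P y>]) l by rewrite has_find -/(pos y) yi.
  by move/(nth_find set0)/asboolP; rewrite -/(pos y) yi.
apply/val_inj => /=; have il : nth set0 l i \in l by rewrite mem_nth.
have hasy : has (fun P => `[<P y>]) l by apply/hasP; exists (nth set0 l i) => //; apply/asboolP.
have /(nth_find set0)/asboolP := hasy; rewrite -/(pos y) => posy.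
have pl : (pos y < size l)%N by rewrite -has_find.
apply/eqP; rewrite -(nth_uniq set0 pl (ltn_ord i) ul); apply/eqP.
by apply: (cell_eq pal _ _ posy yi); apply: lal; rewrite // mem_nth.
Qed.

End Partitions.

Section Joins.
Context {R : realType} {d : measure_display} {Y : measurableType d}.
Variable nu : probability Y R.

Lemma countable_partition_preimage (f : Y -> Y) (al : set_system Y) :
  measurable_fun setT f -> countable_partition al ->
  countable_partition (partition_preimage f al).
Proof.
move=> mf [cal mal triv cov]; split.
- by apply: sub_countable cal; exact: card_image_le.
- by move=> _ [P aP <-]; rewrite -[X in measurable X]setTI; apply: mf => //; exact: mal.
- move=> _ _ [P aP <-] [Q aQ <-] [x [Px Qx]]; congr (_ @^-1` _).
  by apply: (triv P Q) => //; exists (f x).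
- apply/seteqP; split=> // x _; have : setT (f x) by [].
  by rewrite -cov => -[P aP Px]; exists (f @^-1` P) => //; exists P.
Qed.

Lemma countable_partition_join (al be : set_system Y) :
  countable_partition al -> countable_partition be ->
  countable_partition (partition_join al be).
Proof.
move=> pal pbe; have [cal mal _ _] := pal; have [cbe mbe _ _] := pbe; split.
- rewrite /partition_join image2E.
  by apply: sub_countable (countableX cal cbe); exact: card_image_le.
- by move=> _ [P aP [Q bQ <-]]; apply: measurableI; [exact: mal | exact: mbe].
- move=> _ _ [P aP [Q bQ <-]] [P' aP' [Q' bQ' <-]] [x [[Px Qx] [P'x Q'x]]].
  by rewrite (cell_eq pal aP aP' Px P'x) (cell_eq pbe bQ bQ' Qx Q'x).
- apply/seteqP; split=> // x _.
  have [P aP Px] := cell_exists x pal; have [Q bQ Qx] := cell_exists x pbe.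
  by exists (P `&` Q) => //; exists P => //; exists Q.
Qed.

Lemma entropy_preimage_le (f : Y -> Y) (al : set_system Y) :
  countable_partition al -> (forall A, measurable A -> nu (f @^-1` A) = nu A) ->
  (entropy nu (partition_preimage f al) <= entropy nu al)%E.
Proof.
move=> [_ mal _ _] nuf; apply: le_trans (esum_image_le _ _ _) _.
by apply: le_esum => P aP; rewrite nuf //; exact: mal.
Qed.

(** For [p = nu (P `&` Q)], [a = nu P] and [b = nu Q], the loss [a * b] comes from
    [ln x <= x - 1] at [x = a * b / p] and sums up to 1. *)
Lemma eta_le_product (p a b : R) : 0 <= p -> p <= a -> p <= b ->
  eta p <= p * - ln a + p * - ln b + a * b.
Proof.
rewrite le_eqVlt => /predU1P[<-|p0] pa pb.
  by rewrite /eta !mul0r oppr0 !add0r mulr_ge0.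
have a0 : 0 < a by exact: lt_le_trans pa.
have b0 : 0 < b by exact: lt_le_trans pb.
have := ln_le_subr1 (x := a * b / p); rewrite divr_gt0 ?mulr_gt0 // => /(_ isT).
rewrite ln_div ?lnM ?posrE ?mulr_gt0 // => le.
have := ler_wpM2l (ltW p0) le.
have -> : p * (a * b / p - 1) = a * b - p by field; rewrite gt_eqF.
rewrite /eta; move: (ln a) (ln b) (ln p) => la lb lp; nra.
Qed.

(** The sharp bound has no summand 1; this weaker form has a termwise proof, by
    [eta_le_product], without subtracting sums that may be infinite. It serves to
    show that a join has finite entropy. *)
Lemma entropy_join_le (al be : set_system Y) :
  countable_partition al -> countable_partition be ->
  (entropy nu (partition_join al be) <= entropy nu al + entropy nu be + 1)%E.
Proof.
move=> pal pbe; have [_ mal _ _] := pal; have [_ mbe _ _] := pbe.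
pose m (A : set Y) := fine (nu A).
have mE A : measurable A -> (m A)%:E = nu A by move=> mA; rewrite fineK ?fin_num_measure.
have m1 A : measurable A -> m A <= 1.
  by move=> mA; rewrite -lee_fin mE //; exact: probability_le1.
have m0 A : 0 <= m A by rewrite fine_ge0.
have nln A : measurable A -> 0 <= - ln (m A).
  by move=> mA; rewrite oppr_ge0 ln_le0 ?m1.
have sum_cells (ga de : set_system Y) : countable_partition ga ->
    countable_partition de ->
    (\esum_(P in ga) \esum_(Q in de) (m (P `&` Q) * - ln (m P))%:E = entropy nu ga)%E.
  move=> pga pde; have [_ mga _ _] := pga; have [_ mde _ _] := pde.
  apply: eq_esum => P gP; rewrite -mulrN mulrC EFinM mE; last exact: mga.
  rewrite -(esum_cells nu pde (mga _ gP) (nln _ (mga _ gP))); apply: eq_esum => Q dQ.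
  rewrite mulrC EFinM mE 1?setIC //.
  by apply: measurableI; [exact: mde | exact: mga].
have sumX : (\esum_(k in al `*` be) (m (k.1 `&` k.2) * - ln (m k.1))%:E
    = entropy nu al)%E.
  rewrite -(sum_cells al be pal pbe) esum_esum // => P Q aP bQ.
  by rewrite lee_fin mulr_ge0 // nln //; exact: mal.
have sumY : (\esum_(k in al `*` be) (m (k.1 `&` k.2) * - ln (m k.2))%:E
    = entropy nu be)%E.
  rewrite -(sum_cells be al pbe pal) esum_esum; last first.
    by move=> Q P bQ aP; rewrite lee_fin mulr_ge0 // nln //; exact: mbe.
  rewrite (reindex_esum (al `*` be) (be `*`` (fun=> al)) (fun k => (k.2, k.1))).
    by apply: eq_esum => -[P Q] _ /=; rewrite setIC.
  split=> [[P Q] []//|[P Q] [P' Q'] _ _ [-> ->]//|[Q P] [bQ aP]].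
  by exists (P, Q).
have sumXY : (\esum_(k in al `*` be) (m k.1 * m k.2)%:E = 1)%E.
  have one (ga : set_system Y) (c : R) : countable_partition ga -> 0 <= c ->
      (\esum_(P in ga) (c * m P)%:E = c%:E)%E.
    move=> pga c0; rewrite -[RHS]mule1 -(@probability_setT _ _ _ nu).
    rewrite -(esum_cells nu pga measurableT c0); apply: eq_esum => P gP.
    by rewrite setIT EFinM mE //; case: pga => _ + _ _; apply.
  have <- : (\esum_(P in al) (\esum_(Q in be) (m P * m Q)%:E))%E = 1%:E.
    rewrite -(one al 1 pal ler01); apply: eq_esum => P aP.
    by rewrite one // mul1r.
  by rewrite esum_esum // => P Q _ _; rewrite lee_fin mulr_ge0.
have posX k : (al `*` be) k -> (0 <= (m (k.1 `&` k.2) * - ln (m k.1))%:E)%E.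
  by move=> [aP _]; rewrite lee_fin mulr_ge0 // nln //; exact: mal.
have posY k : (al `*` be) k -> (0 <= (m (k.1 `&` k.2) * - ln (m k.2))%:E)%E.
  by move=> [_ bQ]; rewrite lee_fin mulr_ge0 // nln //; exact: mbe.
rewrite -{}sumXY -{}sumX -{}sumY -esumD // -esumD; last 2 first.
- by move=> k k_in; rewrite adde_ge0 ?posX ?posY.
- by move=> k _; rewrite lee_fin mulr_ge0.
rewrite /entropy /partition_join image2E; apply: le_trans (esum_image_le _ _ _) _.
apply: le_esum => -[P Q] [/= aP bQ]; rewrite -!EFinD lee_fin.
have mP := mal _ aP; have mQ := mbe _ bQ; have mPQ := measurableI _ _ mP mQ.
by apply: eta_le_product; rewrite ?fine_ge0 // fine_le ?fin_num_measure //;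
  apply: le_measure; rewrite ?inE // => x [].
Qed.

(** A repeated index would break the equality: joining a partition with itself
    may add the empty cell. *)
Lemma bigjoin_cons (I : eqType) (i : I) (l : seq I) (f : I -> set_system Y) :
  i \notin l -> partition_bigjoin [set` i :: l] f =
    partition_join (f i) (partition_bigjoin [set` l] f).
Proof.
move=> il; apply/seteqP; split=> [A [P fP ->]|_ [Q fQ [_ [P fP ->] <-]]].
  exists (P i); first by apply: fP => /=; rewrite inE eqxx.
  exists (\bigcap_(j in [set` l]) P j).
    by exists P => // j lj; apply: fP => /=; rewrite inE lj orbT.
  apply/seteqP; split=> [x [xi xl] j /=|x xP].
    by rewrite inE => /predU1P[->//|]; exact: xl.
  by split=> [|j /= jl]; apply: xP => /=; rewrite inE ?eqxx ?jl ?orbT.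
exists (fun j => if j == i then Q else P j).
  by move=> j /=; rewrite inE; case: eqP => [->|_ /fP].
apply/seteqP; split=> [x [xQ xP] j /=|x xQP].
  by rewrite inE; case: eqP => [->|_ /xP].
split; first by have := xQP i; rewrite /= inE eqxx => /(_ isT).
move=> j /= jl; have := xQP j; rewrite /= inE jl orbT => /(_ isT).
by case: eqP => [ji|//]; move: il; rewrite -ji jl.
Qed.

Lemma bigjoin_finite_entropy (I : choiceType) (D : set I) (f : I -> set_system Y) :
  finite_set D -> (forall i, countable_partition (f i)) ->
  (forall i, (entropy nu (f i) < +oo)%E) ->
  countable_partition (partition_bigjoin D f) /\
    (entropy nu (partition_bigjoin D f) < +oo)%E.
Proof.
move=> /finite_seqP[l ->] pf ef.
rewrite (_ : [set` l] = [set` undup l]); last first.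
  by apply/seteqP; split=> i /=; rewrite mem_undup.
elim: (undup l) (undup_uniq l) => {l} [_|i l IH /= /andP[il ul]].
  have -> : partition_bigjoin [set` [::]] f = [set setT].
    apply/seteqP; split=> [A [P _ ->]|_ ->].
      by apply/seteqP; split.
    by exists (fun=> setT) => //; apply/seteqP; split.
  split; last by rewrite /entropy esum_set1 probability_setT /= ln1 mulr0 oppr0 ?ltry.
  split; [exact: countable1 | by move=> _ -> | by move=> P Q /= -> -> |].
  by rewrite bigcup_set1.
have [pl el] := IH ul; rewrite bigjoin_cons //.
split; first exact: countable_partition_join.
apply: le_lt_trans (entropy_join_le (pf i) pl) _.
by rewrite !lte_add_pinfty // ltry.
Qed.

End Joins.

Lemma finite_word_ball (G : groupType) (r : nat) (s : 'I_r -> G) n :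
  finite_set (word_ball s n).
Proof.
elim: n => [|n IH].
  apply: (sub_finite_set _ (finite_set1 1%g)) => g [w].
  by rewrite leqn0 => /nilP -> /= <-.
have fin : finite_set (\bigcup_(l in [set: 'I_r * bool])
    [set (letter_val s l * g)%g | g in word_ball s n]).
  by apply: bigcup_finite => [|l _]; [exact: finite_finset | exact: finite_image].
apply: (@sub_finite_set _ _ (_ `|` _) _); last first.
  by rewrite finite_setU; split; [exact: (finite_set1 (1%g : G)) | exact: fin].
move=> g [[|l w] /= wn <-]; first by left.
by right; exists l => //; exists (word_val s w) => //; exists w.
Qed.

(** * Factors of Bernoulli shifts *)

Section Factor.
Context {R : realType} {G : groupType} {r : nat} {s : 'I_r -> G}.
Context {dK : measure_display} {K : measurableType dK}.
Context {dY : measure_display} {Y : measurableType dY}.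
Variables (kappa : probability K R) (mu : probability (config G K) R).
Variables (nu : probability Y R) (S : G -> Y -> Y).
Hypotheses (hG : free_basis s) (hmu : is_product_measure kappa mu).
Hypotheses (hS : mp_action nu S)
  (hfactor : is_factor mu (@bernoulli_shift G dK K) nu S).

(** Entropies depend only on laws of labels. The labels of an edge, pulled back
    along the factor map, agree almost everywhere with those of the Bernoulli
    shift. *)
Lemma factor_edge_vertex_entropy (T : finType) (Z : Y -> T) :
  measurable_label Z ->
  2 * r%:R * label_entropy nu Z <= label_entropy nu Z +
    \sum_(i < r) label_entropy nu (fun y => (Z y, Z (S (s i) y))).
Proof.
move=> mZ; have [phi [mphi phi_nu phi_eq]] := hfactor; have [mS _ _] := hS.
have mpull (U : eqType) (W : Y -> U) : measurable_label W -> measurable_label (W \o phi).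
  by move=> mW u; have := mphi measurableT _ (mW u); rewrite setTI.
have pull (U : finType) (W : Y -> U) : measurable_label W ->
    label_entropy mu (W \o phi) = label_entropy nu W.
  move=> mW; apply: eq_bigr => u _; congr (eta (fine _)).
  exact: (phi_nu _ (mW u)).
have mZS i : measurable_label (fun y => (Z y, Z (S (s i) y))).
  move=> [t u]; rewrite (_ : [set y | _] =
      [set y | Z y = t] `&` (S (s i) @^-1` [set y | Z y = u])).
    apply: measurableI; first exact: mZ.
    by rewrite -[X in measurable X]setTI; apply: mS => //; exact: mZ.
  by apply/seteqP; split=> y /= [-> ->].
have := bernoulli_edge_vertex_entropy hmu hG (mpull _ _ mZ).
rewrite pull // => /le_trans; apply; rewrite lerD2l; apply: ler_sum => i _.
rewrite -(pull _ _ (mZS i)) le_eqVlt; apply/orP; left; apply/eqP.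
have [N [mN N0 sub]] := phi_eq (s i).
apply: eq_bigr => u _; congr eta; apply/eqP.
rewrite -subr_eq0 -normr_le0 (_ : 0 = fine (mu N)); last by rewrite N0.
apply: label_mass_dist mN _.
- by apply: measurable_label_pair_shift; exact: mpull.
- exact: mpull.
- move=> x xN; have [e|ne] := pselect (phi (bernoulli_shift (s i) x) = S (s i) (phi x)).
    by rewrite /= e.
  by case: xN; apply: sub.
Qed.

(** For finitely many cells of [be], their entropy is at most that of the label
    recording them, and the labels of an edge are constant on the cells of the
    join. The supremum over finite sets of cells gives the claim. *)
Lemma F_value_ge0 (be : set_system Y) : countable_partition be ->
  (entropy nu be < +oo)%E -> (0 <= F_value s nu S be)%E.
Proof.
move=> pbe ebe; have [mS _ _] := hS.
have [_ mbe _ _] := pbe.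
pose joint i := partition_join be (partition_preimage (S (s i)) be).
have pjoint i : countable_partition (joint i).
  by apply: countable_partition_join => //; apply: countable_partition_preimage.
have ent_ge0 (al : set_system Y) : countable_partition al -> (0 <= entropy nu al)%E.
  by move=> [_ mal _ _]; apply: esum_ge0 => P /mal; exact: entropy_term_ge0.
have [h hE] : exists h, entropy nu be = h%:E.
  exists (fine (entropy nu be)); rewrite fineK // ge0_fin_numE //; exact: ent_ge0.
have h0 : 0 <= h by rewrite -lee_fin -hE; exact: ent_ge0.
have cells (l : seq (set Y)) : uniq l -> (forall P, P \in l -> be P) ->
    ((2 * r%:R * \sum_(P <- l) eta (fine (nu P)))%:E <=
      h%:E + \sum_(i < r) entropy nu (joint i))%E.
  move=> ul lbe; have [T [Z [cZ lZ]]] := cells_label nu pbe lbe ul.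
  have mZ := measurable_label_cells pbe cZ.
  apply: (@le_trans _ _ (label_entropy nu Z +
      \sum_(i < r) label_entropy nu (fun y => (Z y, Z (S (s i) y))))%:E).
    rewrite lee_fin; apply: le_trans (factor_edge_vertex_entropy mZ).
    by rewrite ler_wpM2l.
  rewrite EFinD leeD //; first by rewrite -hE; exact: label_entropy_le.
  rewrite -sumEFin; apply: lee_sum => i _; apply: label_entropy_le => //.
  move=> _ [P bP [_ [Q bQ <-] <-]] x y [Px Qx] [Py Qy].
  by congr (_, _); [apply: (cZ _ bP) | apply: (cZ _ bQ)].
rewrite /F_value hE -EFinM -[X in (_ + X)%E]/(\sum_(i < r) entropy nu (joint i))%E.
have : (0 <= \sum_(i < r) entropy nu (joint i))%E.
  by apply: sume_ge0 => i _; exact: ent_ge0.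
move: cells; set J := (\sum_(i < r) _)%E.
case: J => [j cells _|_ _|_ //]; last by rewrite addey // leey.
rewrite -EFinD lee_fin.
suff : 2 * r%:R * h <= h + j by lra.
have [r0|r_gt0] := posnP r.
  by rewrite r0 mulr0 mul0r; have := cells [::]; rewrite big_nil mulr0 -EFinD lee_fin; apply.
have c0 : 0 < 2 * r%:R :> R by rewrite mulr_gt0 ?ltr0n.
rewrite mulrC -ler_pdivlMr // -lee_fin -hE.
apply: ge_ereal_sup => _ [F [/finite_seqP[l ->] lbe] <-].
have lE : [set` l] = [set` undup l] by apply/seteqP; split=> P /=; rewrite mem_undup.
rewrite lE -fsbig_seq ?undup_uniq // sumEFin lee_fin ler_pdivlMr // mulrC -lee_fin.
by apply: cells => [|P]; [exact: undup_uniq | rewrite mem_undup => /lbe].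
Qed.

End Factor.

Theorem corollary1p8 (R : realType) (G : groupType) (r : nat) (s : 'I_r -> G)
    (hG : free_basis s)
    (dK : measure_display) (K : measurableType dK)
    (hK : countable [set: K]) (hKdisc : forall A : set K, measurable A)
    (kappa : probability K R)
    (mu : probability (config G K) R) (hmu : is_product_measure kappa mu)
    (dY : measure_display) (Y : measurableType dY) (hY : standard_borel R Y)
    (nu : probability Y R) (S : G -> Y -> Y) (hS : mp_action nu S)
    (hfactor : is_factor mu (@bernoulli_shift G dK K) nu S)
    (hgen : exists2 beta : set_system Y,
              finite_set beta & generating nu S beta) :
  forall c : \bar R, is_f_invariant s nu S c -> (0 <= c)%E.
Proof.
move=> _ [al [[pal _] al_fin ->]]; apply: le_ereal_inf_tmp => _ [n _ <-].
have [mS nuS _] := hS.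
have [||pball ball_fin] := @bigjoin_finite_entropy _ _ _ nu _ (word_ball s n)
  (fun g => partition_preimage (S g) al) (finite_word_ball s n).
- by move=> g; apply: countable_partition_preimage.
- by move=> g; apply: le_lt_trans al_fin; apply: entropy_preimage_le pal (nuS g).
exact: (F_value_ge0 hG hmu hS hfactor pball ball_fin).
Qed.
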